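(* Let $\phi\in\mathcal{S}(\mathbb{R})$ and define $\phi_n(\xi)=\phi(\xi-n)$ for $n\in\mathbb{Z}$. Then for all exponents $2<p_1,p_2\le\infty$ and $1<p_3\le 2$ satisfying $\frac1{p_1}+\frac1{p_2}=\frac1{p_3}$, there is a constant $C>0$ such that for all $f,g\in\mathcal{S}(\mathbb{R})$, $$\left\|\Big(\sum_{n\in\mathbb{Z}}|T_{\phi_n}(f,g)|^2\Big)^{1/2}\right\|_{L^{p_3}(\mathbb{R})}\le C\,\|f\|_{L^{p_1}(\mathbb{R})}\,\|g\|_{L^{p_2}(\mathbb{R})}.$$
   Context: $\mathcal{S}(\mathbb{R})$ is the Schwartz space. For a bounded function $\phi_n$ on $\mathbb{R}$, $$T_{\phi_n}(f,g)(x)=\int_{\mathbb{R}}\int_{\mathbb{R}}\widehat f(\xi)\widehat g(\eta)\phi_n(\xi-\eta)e^{2\pi i x(\xi+\eta)}\,d\xi\,d\eta,\qquad \widehat f(\xi)=\int_{\mathbb{R}}f(x)e^{-2\pi i x\xi}\,dx .$$ *)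

(* Defs.v *)
From mathcomp Require Import all_boot all_order all_algebra.
From mathcomp Require Export complex.
From mathcomp Require Import all_classical all_reals all_analysis.

Set Implicit Arguments.
Unset Strict Implicit.
Unset Printing Implicit Defensive.

Import Order.TTheory GRing.Theory Num.Theory.
Import numFieldNormedType.Exports.

Local Open Scope classical_set_scope.
Local Open Scope ring_scope.
Local Open Scope complex_scope.

(* Derivatives and integrals of [R[i]]-valued functions of a real variable are
   taken componentwise, since [R[i]] is not a normed module over [R] here. *)
Definition csmooth (R : realType) (f : R -> R[i]) : Prop :=
  forall (n : nat) (x : R),
    derivable (derive1n n (fun y => complex.Re (f y) : R)) x 1 /\
    derivable (derive1n n (fun y => complex.Im (f y) : R)) x 1.

Definition cderive (R : realType) (n : nat) (f : R -> R[i]) (x : R) : R[i] :=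
  derive1n n (fun y => complex.Re (f y) : R) x +i* derive1n n (fun y => complex.Im (f y) : R) x.

Definition cintegral (R : realType) (f : R -> R[i]) : R[i] :=
  (\int[lebesgue_measure]_x complex.Re (f x)) +i* (\int[lebesgue_measure]_x complex.Im (f x)).

Definition schwartz (R : realType) (f : R -> R[i]) : Prop :=
  csmooth f /\
  forall k n : nat, exists M : R, forall x : R,
    `|x| ^+ k * Normc.normc (cderive n f x) <= M.

(* e(t) = exp(2 pi i t) *)
Definition e2pii (R : realType) (t : R) : R[i] :=
  cos (2 * pi * t) +i* sin (2 * pi * t).

Definition fourier (R : realType) (f : R -> R[i]) (xi : R) : R[i] :=
  cintegral (fun x => f x * e2pii (- (x * xi))).

(* The inner integral is over [xi], the outer one over [eta]. *)
Definition bilinear_multiplier (R : realType) (m : R -> R[i])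
    (f g : R -> R[i]) (x : R) : R[i] :=
  cintegral (fun eta => cintegral (fun xi =>
    fourier f xi * fourier g eta * m (xi - eta) * e2pii (x * (xi + eta)))).

(* [Lnorm] at exponent [+oo] is the essential supremum. *)
Definition cLnorm (R : realType) (p : \bar R) (f : R -> R[i]) : \bar R :=
  Lnorm (@lebesgue_measure R) p (fun x => (Normc.normc (f x))%:E).

(* The unordered sum over the integers and its square root are taken in
   [\bar R], so the square function is allowed to be infinite. *)
Definition square_function (R : realType) (F : int -> R -> R[i]) (x : R)
    : \bar R :=
  ((\esum_(n in [set: int]) ((Normc.normc (F n x)) ^+ 2)%:E) `^ (2^-1 : R))%E.

(* Main.v *)
Require Import Defs.
From mathcomp Require Import all_boot all_order all_algebra ring lra zify.
From mathcomp Require Import all_classical all_reals all_analysis.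
From mathcomp Require Import measurable_realfun.
Import Order.TTheory GRing.Theory Num.Theory.
Import numFieldNormedType.Exports.
Set Implicit Arguments.
Unset Strict Implicit.
Unset Printing Implicit Defensive.
Local Open Scope classical_set_scope.
Local Open Scope complex_scope.
Local Open Scope ring_scope.

(** Let kappa be the Fourier transform of phi.  Fourier inversion, applied to
    phi, f and g, turns the multiplier into an integral over physical space:
    T_{phi_n}(f,g)(x) is the value at frequency n of the Fourier transform of
      h_x(t) = kappa(t) f(x + t) g(x - t)
    ([bilinear_multiplierE]).  Summing over the integers n is then a matter of
    almost orthogonality: the squares of the values of a Fourier transform at
    the integers sum to at most a constant times the integral of
    |h(t)|^2 (1 + t^2) ([weighted_bessel]).  As kappa decays rapidly, the square
    of the square function is at most a constant times
      A(x) = int w(t)^2 F(x + t) G(x - t) dt,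
    where w(t) = 1/(1 + t^2), F = |f|^2 and G = |g|^2 ([esum_multiplier_le]).

    It remains to bound the L^q quasi-norm of A by the L^{p1/2} norm of F times
    the L^{p2/2} norm of G, with q = p3/2 at most 1 ([pair_avg_bound]).  Below
    exponent 1 this needs localization.  Weight x by w(x - y)^2 for a centre y:
    Jensen's inequality takes the power q out of the x-integral, and since
      w(t)^2 w(x - y)^2 <= 4 w(x + t - y) w(x - t - y)
    the substitution u = x + t, v = x - t decouples F from G.  The outcome is the
    product of the averages of F and G against w centred at y.  Hoelder's
    inequality in y, followed by Jensen's inequality with the exponents p1/2 and
    p2/2, both at least 1, concludes.  An infinite exponent does not occur:
    p1 = +oo would force p2 = p3 <= 2.  *)

(** * Integrals of non-negative functions and affine changes of variable *)

Section integral_comparison.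
Local Open Scope ereal_scope.

(** Compares the suprema over simple functions that define the two integrals; it
    is meant for integrands such as the square function, which are bounded by
    measurable majorants. *)
Lemma ge0_le_integralT d (T : measurableType d) (R : realType)
    (m : {measure set T -> \bar R}) (f g : T -> \bar R) :
  (forall x, 0 <= f x) -> (forall x, f x <= g x) ->
  \int[m]_x f x <= \int[m]_x g x.
Proof.
move=> f0 fg.
rewrite !ge0_integralTE//; last by move=> x; exact: le_trans (f0 x) (fg x).
apply: ereal_sup_le => _ [h /= hf <-].
by exists h => //= x; exact: le_trans (hf x) (fg x).
Qed.

End integral_comparison.

Section affine_change_of_variable.
Context (R : realType).
Local Notation mu := (@lebesgue_measure R).
Implicit Types (a c : R).

Let aff a c : measurableTypeR R -> measurableTypeR R := fun x => a + c * x.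

Lemma measurable_affine a c : measurable_fun [set: R] (fun x : R => a + c * x).
Proof. by apply: measurable_funD => //; apply: measurable_funM. Qed.

(** Both sides are measures that agree on half-open intervals. *)
Let lebesgue_measure_affine_pos a c (c0 : 0 < c) (A : set R) : measurable A ->
  (c%:E * pushforward mu (aff a c) A)%E = mu A.
Proof.
move=> mA.
have mf : measurable_fun [set: measurableTypeR R] (aff a c).
  exact: measurable_affine.
pose cn := NngNum (ltW c0).
rewrite (_ : (c%:E * _)%E = mscale cn (pushforward mu (aff a c)) A)//.
apply/esym/lebesgue_measure_unique => // _ [[p q]] /= _ <-.
rewrite /mscale/= /pushforward.
have -> : aff a c @^-1` `]p, q] = `](p - a) / c, (q - a) / c]%classic.
  apply/seteqP; split => x /=; rewrite /aff !in_itv/= ltr_pdivrMr// ler_pdivlMr//;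
  move=> /andP[h1 h2]; apply/andP; split; lra.
rewrite !lebesgue_measure_itv/= !lte_fin ltr_pM2r ?invr_gt0// ltrD2r.
case: ifPn => pq; last by rewrite mule0.
rewrite -!EFinB -EFinM -mulrBl mulrCA divff ?gt_eqF// mulr1; congr (_%:E); ring.
Qed.

Lemma ge0_integral_affine_pos a c (f : R -> \bar R) : 0 < c ->
  measurable_fun setT f -> (forall x, 0 <= f x)%E ->
  (\int[mu]_x f x = c%:E * \int[mu]_x f (a + c * x)%R)%E.
Proof.
move=> c0 mf f0.
have mg : measurable_fun [set: measurableTypeR R] (aff a c).
  exact: measurable_affine.
have := @ge0_integral_pushforward _ _ _ _ _ (aff a c) mg mu setT f
  measurableT mf (fun x _ => f0 x).
rewrite preimage_setT /comp => <-.
pose cn := NngNum (ltW c0).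
rewrite -[c]/(cn%:num) -ge0_integral_mscale//.
apply: eq_measure_integral => A mA _.
exact/esym/(lebesgue_measure_affine_pos a c0 mA).
Qed.

Lemma ge0_integral_opp (f : R -> \bar R) :
  measurable_fun setT f -> (forall x, 0 <= f x)%E ->
  (\int[mu]_x f x = \int[mu]_x f (- x)%R)%E.
Proof.
move=> mf f0.
have := @ge0_integral_pushforward _ _ _ _ _ (-%R : measurableTypeR R -> measurableTypeR R)
  (@oppr_measurable _ setT) mu setT f measurableT mf (fun x _ => f0 x).
rewrite preimage_setT /comp => <-.
by apply: eq_measure_integral => A mA _; exact/esym/lebesgue_measureN.
Qed.

Lemma ge0_integral_affine a c (f : R -> \bar R) : c != 0 ->
  measurable_fun setT f -> (forall x, 0 <= f x)%E ->
  (\int[mu]_x f x = `|c|%:E * \int[mu]_x f (a + c * x)%R)%E.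
Proof.
move=> c0 mf f0; have [cn|cp] := ltP c 0; last first.
  rewrite ger0_norm//; apply: ge0_integral_affine_pos => //.
  by rewrite lt_neqAle eq_sym c0.
rewrite ltr0_norm// (@ge0_integral_affine_pos a (- c))// ?oppr_gt0//.
congr (_ * _)%E; rewrite ge0_integral_opp//.
  by apply: eq_integral => x _; rewrite mulrNN.
by apply: (measurableT_comp mf); exact: measurable_affine.
Qed.

(** This is an identity in the extended reals, whether or not the integral is
    defined: scaling by a positive real commutes with subtraction even for oo - oo. *)
Lemma integral_affine a c (f : R -> \bar R) : c != 0 ->
  measurable_fun setT f ->
  (\int[mu]_x f x = `|c|%:E * \int[mu]_x f (a + c * x)%R)%E.
Proof.
move=> c0 mf; rewrite [LHS]integralE [in RHS]integralE.
have c0' : 0 < `|c| by rewrite normr_gt0.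
have muleBr_pos (u v : \bar R) :
    (`|c|%:E * (u - v) = `|c|%:E * u - `|c|%:E * v)%E.
  by case: u v => [u||] [v||] //=; rewrite -?EFinB -?EFinM -?EFinB ?mulrBr//
    ?(gt0_muley, gt0_muleNy) ?lte_fin.
rewrite muleBr_pos; congr (_ - _)%E.
  rewrite (@ge0_integral_affine a c _ c0 (measurable_funepos mf)
    (fun x => funepos_ge0 f x)); congr (_ * _)%E.
  by apply: eq_integral => x _; rewrite !funeposE.
rewrite (@ge0_integral_affine a c _ c0 (measurable_funeneg mf)
    (fun x => funeneg_ge0 f x)); congr (_ * _)%E.
by apply: eq_integral => x _; rewrite !funenegE.
Qed.

Lemma integrable_affine a c (f : R -> R) : c != 0 ->
  mu.-integrable setT (EFin \o f) ->
  mu.-integrable setT (EFin \o (fun x => f (a + c * x))).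
Proof.
move=> c0 /integrableP[mf foo]; apply/integrableP; split.
  by apply: (measurableT_comp mf); exact: measurable_affine.
have c0' : 0 < `|c| by rewrite normr_gt0.
move: foo; rewrite (@ge0_integral_affine a c)//; last exact: measurableT_comp.
set I := (X in (_ * X)%E) => foo.
rewrite -/I ltey; apply: contraTneq foo => ->.
by rewrite gt0_muley ?lte_fin.
Qed.

(** When the integral is infinite, both sides are 0. *)
Lemma Rintegral_affine a c (f : R -> R) : c != 0 ->
  measurable_fun setT f ->
  \int[mu]_x f x = `|c| * \int[mu]_x f (a + c * x).
Proof.
move=> c0 mf; rewrite /Rintegral (@integral_affine a c)//; last exact/measurable_EFinP.
set I := (\int[mu]_x (f (a + c * x))%:E)%E; move: I => [r| |] //=.
  by rewrite gt0_muley ?lte_fin ?normr_gt0//= mulr0.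
by rewrite gt0_muleNy ?lte_fin ?normr_gt0//= mulr0.
Qed.

End affine_change_of_variable.

(** * Integration of complex-valued functions of a real variable *)

Section complex_components.
Context (R : realType).
Local Notation Re := (@complex.Re R).
Local Notation Im := (@complex.Im R).
Local Notation normc := (@Normc.normc R).
Implicit Types z w : R[i].

Lemma Re_mul z w : Re (z * w) = Re z * Re w - Im z * Im w.
Proof. by case: z w => [a b] [c d]. Qed.

Lemma Im_mul z w : Im (z * w) = Re z * Im w + Im z * Re w.
Proof. by case: z w => [a b] [c d]. Qed.

Lemma Re_add z w : Re (z + w) = Re z + Re w.
Proof. by case: z w => [a b] [c d]. Qed.

Lemma Im_add z w : Im (z + w) = Im z + Im w.
Proof. by case: z w => [a b] [c d]. Qed.

Lemma complex_ext z w : Re z = Re w -> Im z = Im w -> z = w.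
Proof. by case: z w => [a b] [c d] /= -> ->. Qed.

Lemma normc_ge0 z : 0 <= normc z.
Proof. by case: z => a b; exact: sqrtr_ge0. Qed.

Lemma sqr_normc z : normc z ^+ 2 = Re z ^+ 2 + Im z ^+ 2.
Proof. by case: z => a b; rewrite sqr_sqrtr// addr_ge0// sqr_ge0. Qed.

Lemma normr_Re_le z : `|Re z| <= normc z.
Proof.
rewrite -[leRHS]ger0_norm ?normc_ge0// -ler_sqr ?nnegrE//.
by rewrite !real_normK ?num_real// sqr_normc lerDl sqr_ge0.
Qed.

Lemma normr_Im_le z : `|Im z| <= normc z.
Proof.
rewrite -[leRHS]ger0_norm ?normc_ge0// -ler_sqr ?nnegrE//.
by rewrite !real_normK ?num_real// sqr_normc lerDr sqr_ge0.
Qed.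

Lemma normc_le_add z : normc z <= `|Re z| + `|Im z|.
Proof.
rewrite -ler_sqr ?nnegrE ?normc_ge0 ?addr_ge0// sqr_normc sqrrD !real_normK ?num_real//.
by have := mulr_ge0 (normr_ge0 (Re z)) (normr_ge0 (Im z)); lra.
Qed.

Lemma e2piiD (s t : R) : e2pii (s + t) = e2pii s * e2pii t.
Proof.
apply: complex_ext; rewrite ?Re_mul ?Im_mul /= mulrDr ?cosD ?sinD//.
by ring.
Qed.

Lemma normc_e2pii (t : R) : normc (e2pii t) = 1.
Proof. by rewrite /= cos2Dsin2 sqrtr1. Qed.

Lemma normcM z w : normc (z * w) = normc z * normc w.
Proof. exact: Normc.normcM. Qed.

End complex_components.

Section complex_measurability.
Context (R : realType) d (T : measurableType d).
Local Notation Re := (@complex.Re R).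
Local Notation Im := (@complex.Im R).
Local Notation normc := (@Normc.normc R).
Implicit Types f g : T -> R[i].

(** Componentwise, to match [cintegral]. *)
Definition cmeasurable f :=
  measurable_fun setT (fun x => Re (f x)) /\ measurable_fun setT (fun x => Im (f x)).

Lemma cmeasurableM f g : cmeasurable f -> cmeasurable g -> cmeasurable (fun x => f x * g x).
Proof.
move=> [f1 f2] [g1 g2]; split.
  under eq_fun do rewrite Re_mul.
  by apply: measurable_funB; apply: measurable_funM.
under eq_fun do rewrite Im_mul.
by apply: measurable_funD; apply: measurable_funM.
Qed.

Lemma cmeasurable_cst (c : R[i]) : cmeasurable (fun=> c).
Proof. by split. Qed.

Lemma cmeasurable_normc f : cmeasurable f -> measurable_fun setT (fun x => normc (f x)).
Proof.
move=> [f1 f2].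
have -> : (fun x => normc (f x)) = (fun x => Num.sqrt (Re (f x) ^+ 2 + Im (f x) ^+ 2)).
  by apply/funext => x; case: (f x).
have mg : measurable_fun setT (fun x => Re (f x) ^+ 2 + Im (f x) ^+ 2).
  by apply: measurable_funD; apply: measurable_funX.
have ms : measurable_fun setT (@Num.sqrt R).
  exact: (continuous_measurable_fun (@sqrt_continuous R)).
exact: (measurableT_comp ms mg).
Qed.

Lemma cmeasurable_e2pii (h : T -> R) : measurable_fun setT h ->
  cmeasurable (fun x => e2pii (h x)).
Proof.
move=> mh; have mg : measurable_fun setT (fun x => 2 * pi * h x).
  exact: measurable_funM.
split=> /=.
  exact: (measurableT_comp (continuous_measurable_fun (@continuous_cos R)) mg).
exact: (measurableT_comp (continuous_measurable_fun (@continuous_sin R)) mg).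
Qed.

End complex_measurability.

Lemma cmeasurable_comp (R : realType) d d' (T : measurableType d) (T' : measurableType d')
    (f : T' -> R[i]) (h : T -> T') :
  cmeasurable f -> measurable_fun setT h -> cmeasurable (fun x => f (h x)).
Proof.
move=> [f1 f2] mh; split.
  exact: (measurableT_comp f1).
exact: (measurableT_comp f2).
Qed.

Section complex_integral.
Context (R : realType).
Local Notation Re := (@complex.Re R).
Local Notation Im := (@complex.Im R).
Local Notation normc := (@Normc.normc R).
Local Notation mu := (@lebesgue_measure R).
Implicit Types f g : R -> R[i].

Definition rintegrable (h : R -> R) := mu.-integrable setT (EFin \o h).

Definition cintegrable f := rintegrable (fun x => Re (f x)) /\ rintegrable (fun x => Im (f x)).

Lemma rintegrable_le (h k : R -> R) : measurable_fun setT h -> rintegrable k ->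
  (forall x, `|h x| <= k x) -> rintegrable h.
Proof.
move=> mh ik hk; apply: (le_integrable measurableT _ _ ik) => //.
  exact/measurable_EFinP.
move=> x _ /=; rewrite lee_fin (le_trans (hk x))// ler_norm//.
Qed.

Lemma rintegrable_meas (h : R -> R) : rintegrable h -> measurable_fun setT h.
Proof. by move=> /measurable_int/measurable_EFinP. Qed.

Lemma rintegrableD (h k : R -> R) : rintegrable h -> rintegrable k -> rintegrable (fun x => h x + k x).
Proof. by move=> ih ik; exact: (integrableD measurableT ih ik). Qed.

Lemma rintegrableZl (c : R) (h : R -> R) : rintegrable h -> rintegrable (fun x => c * h x).
Proof. by move=> ih; exact: (integrableZl measurableT c ih). Qed.

Lemma rintegrable_norm (h : R -> R) : rintegrable h -> rintegrable (fun x => `|h x|).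
Proof. by move=> ih; exact: (integrable_norm ih). Qed.

Lemma cintegrable_meas f : cintegrable f -> cmeasurable f.
Proof. by move=> [i1 i2]; split; exact: rintegrable_meas. Qed.

Lemma cintegrable_le f (k : R -> R) : cmeasurable f -> rintegrable k ->
  (forall x, normc (f x) <= k x) -> cintegrable f.
Proof.
move=> [m1 m2] ik fk; split.
  exact: (rintegrable_le m1 ik (fun x => le_trans (normr_Re_le _) (fk x))).
exact: (rintegrable_le m2 ik (fun x => le_trans (normr_Im_le _) (fk x))).
Qed.

Lemma cintegrable_normc f : cintegrable f -> rintegrable (fun x => normc (f x)).
Proof.
move=> cf; have [i1 i2] := cf.
apply: (@rintegrable_le _ (fun x => `|Re (f x)| + `|Im (f x)|)).
- exact/cmeasurable_normc/cintegrable_meas.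
- by apply: rintegrableD; exact: rintegrable_norm.
- by move=> x; rewrite ger0_norm ?normc_ge0//; exact: normc_le_add.
Qed.

Lemma cintegrable_mul_bounded f g (M : R) : cintegrable f -> cmeasurable g ->
  (forall x, normc (g x) <= M) -> cintegrable (fun x => f x * g x).
Proof.
move=> cf mg gM; apply: (@cintegrable_le _ (fun x => M * normc (f x))).
- by apply: cmeasurableM => //; exact: cintegrable_meas.
- exact/rintegrableZl/cintegrable_normc.
- by move=> x; rewrite normcM mulrC ler_wpM2r ?normc_ge0.
Qed.

Lemma cintegrable_e2pii f (h : R -> R) : cintegrable f -> measurable_fun setT h ->
  cintegrable (fun x => f x * e2pii (h x)).
Proof.
move=> cf mh; apply: (cintegrable_mul_bounded (M := 1) cf) => [|x].
  exact: cmeasurable_e2pii.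
by rewrite normc_e2pii.
Qed.

Lemma cintegrable_affine f (a c : R) : c != 0 -> cintegrable f -> cintegrable (fun x => f (a + c * x)).
Proof.
move=> c0 [i1 i2]; split.
  exact: (@integrable_affine R a c (fun x => Re (f x)) c0 i1).
exact: (@integrable_affine R a c (fun x => Im (f x)) c0 i2).
Qed.

Lemma cintegral_affine f (a c : R) : c != 0 -> cmeasurable f ->
  cintegral f = (`|c|)%:C * cintegral (fun x => f (a + c * x)).
Proof.
move=> c0 [i1 i2]; apply: complex_ext; rewrite ?Re_mul ?Im_mul /= mul0r ?subr0 ?addr0.
  exact: (Rintegral_affine a c0).
exact: (Rintegral_affine a c0).
Qed.

Lemma cintegral_translate f (a : R) : cmeasurable f ->
  cintegral f = cintegral (fun x => f (a + x)).
Proof.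
move=> mf; rewrite (cintegral_affine a (oner_neq0 R) mf) normr1 mul1r.
by congr cintegral; apply/funext => x; rewrite mul1r.
Qed.

Lemma cintegralZl (c : R[i]) f : cintegrable f ->
  cintegral (fun x => c * f x) = c * cintegral f.
Proof.
move=> [i1 i2]; apply: complex_ext; rewrite /= ?Re_mul ?Im_mul /=.
  under eq_Rintegral do rewrite Re_mul.
  by rewrite RintegralB ?RintegralZl//; exact: rintegrableZl.
under eq_Rintegral do rewrite Im_mul.
by rewrite RintegralD ?RintegralZl//; exact: rintegrableZl.
Qed.

Lemma cintegralZr (c : R[i]) f : cintegrable f ->
  cintegral (fun x => f x * c) = cintegral f * c.
Proof.
move=> cf; rewrite mulrC -cintegralZl//.
by congr cintegral; apply/funext => x; rewrite mulrC.
Qed.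

Lemma cintegralD f g : cintegrable f -> cintegrable g ->
  cintegral (fun x => f x + g x) = cintegral f + cintegral g.
Proof.
move=> [f1 f2] [g1 g2]; apply: complex_ext; rewrite /= ?Re_add ?Im_add /=.
  by under eq_Rintegral do rewrite Re_add; rewrite RintegralD.
by under eq_Rintegral do rewrite Im_add; rewrite RintegralD.
Qed.

End complex_integral.

Section complex_Fubini.
Context (R : realType).
Local Notation Re := (@complex.Re R).
Local Notation Im := (@complex.Im R).
Local Notation normc := (@Normc.normc R).
Local Notation mu := (@lebesgue_measure R).

Lemma rintegrable_ltoo (h : R -> R) : (forall x, 0 <= h x) -> rintegrable h ->
  (\int[mu]_x (h x)%:E < +oo)%E.
Proof.
move=> h0 /integrableP[_]; congr (_ < _)%E.
by apply: eq_integral => x _ /=; rewrite ger0_norm.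
Qed.

Lemma rintegrableE (h : R -> R) : rintegrable h -> (\int[mu]_x (h x)%:E = (\int[mu]_x h x)%:E)%E.
Proof. by move=> ih; rewrite /Rintegral fineK//; exact: (integrable_fin_num measurableT ih). Qed.

(** Under a bound a(x) b(y) every section is integrable, not just almost every
    one, so the inner integrals are genuine real numbers for all parameters. *)
Section real_Fubini.
Variables (f : R * R -> R) (a b : R -> R).
Hypothesis (mf : measurable_fun setT f).
Hypothesis (ia : rintegrable a) (ib : rintegrable b).
Hypothesis fab : forall x y, `|f (x, y)| <= a x * b y.

Lemma prod_dominated_integrable : (mu \x mu)%E.-integrable setT (EFin \o f).
Proof.
have mfE : measurable_fun setT (EFin \o f) by exact/measurable_EFinP.
apply/integrable12ltyP => //.
have mabs : measurable_fun setT (fun z => `|(EFin \o f) z|)%E.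
  exact: measurableT_comp.
apply: (@le_lt_trans _ _ (\int[mu]_x \int[mu]_y (`|a x| * `|b y|)%:E)%E).
  apply: ge0_le_integralT => x; first exact: integral_ge0.
  apply: ge0_le_integralT => y //=.
  by rewrite lee_fin (le_trans (fab x y))// -normrM ler_norm.
have ib' := rintegrable_norm ib; have ia' := rintegrable_norm ia.
have E x : (\int[mu]_y (`|a x| * `|b y|)%:E =
    (`|a x| * \int[mu]_y `|b y|)%:E)%E.
  by rewrite (rintegrableE (rintegrableZl _ ib')) RintegralZl.
under eq_integral do rewrite E mulrC.
apply: rintegrable_ltoo => [x|]; last exact: rintegrableZl.
by rewrite mulr_ge0// Rintegral_ge0.
Qed.

Let imf := prod_dominated_integrable.

Lemma rintegrable_section1 x : rintegrable (fun y => f (x, y)).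
Proof.
apply: (rintegrable_le _ (rintegrableZl (a x) ib)) => [|y]; last exact: fab.
exact: (measurableT_comp mf (pair1_measurable x)).
Qed.

Lemma rintegrable_section2 y : rintegrable (fun x => f (x, y)).
Proof.
apply: (rintegrable_le _ (rintegrableZl (b y) ia)) => [|x]; last by rewrite mulrC; exact: fab.
exact: (measurableT_comp mf (pair2_measurable y)).
Qed.

Lemma rintegrable_fubini1 : rintegrable (fun x => \int[mu]_y f (x, y)).
Proof.
have := integrable_fubini_F imf; rewrite /rintegrable; congr (integrable _ _ _).
by apply/funext => x /=; rewrite -rintegrableE//; exact: rintegrable_section1.
Qed.

Lemma Rintegral_Fubini :
  \int[mu]_x (\int[mu]_y f (x, y)) = \int[mu]_y (\int[mu]_x f (x, y)).
Proof.
rewrite /Rintegral; congr fine.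
have := Fubini imf => /=.
under eq_integral => x _ do rewrite (rintegrableE (rintegrable_section1 x)).
under [RHS]eq_integral => y _ do rewrite (rintegrableE (rintegrable_section2 y)).
by [].
Qed.

End real_Fubini.

Section complex.
Variables (F : R * R -> R[i]) (a b : R -> R).
Hypothesis (mF : cmeasurable F).
Hypothesis (ia : rintegrable a) (ib : rintegrable b).
Hypothesis Fab : forall x y, normc (F (x, y)) <= a x * b y.

Lemma cintegrable_fubini1 : cintegrable (fun x => cintegral (fun y => F (x, y))).
Proof.
have [m1 m2] := mF.
split => /=.
  apply: (rintegrable_fubini1 m1 ia ib) => x y.
  exact: le_trans (normr_Re_le _) (Fab x y).
apply: (rintegrable_fubini1 m2 ia ib) => x y.
exact: le_trans (normr_Im_le _) (Fab x y).
Qed.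

Lemma cintegral_Fubini :
  cintegral (fun x => cintegral (fun y => F (x, y))) =
  cintegral (fun y => cintegral (fun x => F (x, y))).
Proof.
have [m1 m2] := mF.
apply: complex_ext => /=.
  apply: (Rintegral_Fubini m1 ia ib) => x y.
  exact: le_trans (normr_Re_le _) (Fab x y).
apply: (Rintegral_Fubini m2 ia ib) => x y.
exact: le_trans (normr_Im_le _) (Fab x y).
Qed.

End complex.

(** Both sides are the double integral of a(s) b(t) e(cst), where e(t) is
    [e2pii t]. *)
Lemma multiplication_formula (c : R) (a b : R -> R[i]) : cintegrable a -> cintegrable b ->
  cintegral (fun s => a s * cintegral (fun t => b t * e2pii (c * (s * t)))) =
  cintegral (fun t => b t * cintegral (fun s => a s * e2pii (c * (s * t)))).
Proof.
move=> ca cb.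
pose F (z : R * R) := a z.1 * b z.2 * e2pii (c * (z.1 * z.2)).
have mF : cmeasurable F.
  apply: cmeasurableM; first apply: cmeasurableM.
  - exact: (cmeasurable_comp (cintegrable_meas ca) measurable_fst).
  - exact: (cmeasurable_comp (cintegrable_meas cb) measurable_snd).
  - by apply: cmeasurable_e2pii; apply: measurable_funM => //; exact: (measurable_funM measurable_fst measurable_snd).
have Fab x y : normc (F (x, y)) <= normc (a x) * normc (b y).
  by rewrite /F /= !normcM normc_e2pii mulr1.
have := cintegral_Fubini mF (cintegrable_normc ca) (cintegrable_normc cb) Fab.
rewrite /F /= => E; transitivity (cintegral (fun x => cintegral (fun y =>
    a x * b y * e2pii (c * (x * y))))).
  congr cintegral; apply/funext => s; rewrite -cintegralZl.
    by congr cintegral; apply/funext => t; rewrite mulrA.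
  by apply: cintegrable_e2pii cb _; apply: measurable_funM => //; apply: measurable_funM.
rewrite E; congr cintegral; apply/funext => t; rewrite -cintegralZl.
  by congr cintegral; apply/funext => s; rewrite -mulrA mulrCA.
by apply: cintegrable_e2pii ca _; apply: measurable_funM => //; apply: measurable_funM.
Qed.

End complex_Fubini.

(** * The Poisson kernel *)

Section poisson_kernel.
Context (R : realType).
Local Notation mu := (@lebesgue_measure R).
Implicit Types b c x : R.

(** Up to the factor 1/pi, the Poisson kernel at height one.  This weight also
    serves as the localizing weight of all later estimates. *)
Definition wt x : R := (1 + x ^+ 2)^-1.

Lemma wt_gt0 x : 0 < wt x.
Proof. by rewrite invr_gt0 ltr_pwDl// sqr_ge0. Qed.

Lemma wt_ge0 x : 0 <= wt x. Proof. exact/ltW/wt_gt0. Qed.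

Lemma wt_le1 x : wt x <= 1.
Proof. by rewrite /wt invf_le1 ?lerDl ?sqr_ge0// ltr_pwDl// sqr_ge0. Qed.

Lemma continuous_wt : continuous wt.
Proof. exact: (@continuous_oneDsqrV R). Qed.

Lemma measurable_wt : measurable_fun setT wt.
Proof. exact: (continuous_measurable_fun continuous_wt). Qed.

Lemma integral_wt : (\int[mu]_x (wt x)%:E = pi%:E)%E.
Proof.
have even : wt =1 wt \o -%R by move=> x /=; rewrite /wt sqrrN.
rewrite (ge0_symfun_integralT wt_ge0 continuous_wt even).
by rewrite -set_itvcy (integral0y_oneDsqr R) -EFinM; congr _%:E; field.
Qed.

Lemma rintegrable_wt : rintegrable wt.
Proof.
apply/integrableP; split; first by apply/measurable_EFinP; exact: measurable_wt.
under eq_integral => x _ do rewrite /= ger0_norm ?wt_ge0//.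
by rewrite integral_wt ltry.
Qed.

Lemma Rintegral_wt : \int[mu]_x wt x = pi.
Proof. by rewrite /Rintegral integral_wt. Qed.

(** The Abel summation factor, whose Fourier transform is a Poisson kernel. *)
Definition abel c x : R := expR (- (c * `|x|)).

Lemma abel_ge0 c x : 0 <= abel c x. Proof. exact: expR_ge0. Qed.

Lemma abel_le1 c x : 0 < c -> abel c x <= 1.
Proof. by move=> c0; rewrite -expR0 ler_expR oppr_le0 mulr_ge0// ltW. Qed.

Lemma continuous_abel c : continuous (abel c).
Proof.
move=> x; apply: (@continuous_comp _ _ _ (fun x : R => - (c * `|x|)) expR).
  apply: cvgN; apply: cvgM; first exact: cvg_cst.
  exact: norm_continuous.
exact: continuous_expR.
Qed.

Lemma continuous_scale (f : R -> R) b : continuous f -> continuous (fun x => f (b * x)).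
Proof.
move=> cf x; apply: (@continuous_comp _ _ _ (fun x : R => b * x) f); last exact: cf.
by apply: cvgM; [exact: cvg_cst|exact: cvg_id].
Qed.

Lemma is_derive_mulr (f g : R -> R) x (df dg : R) :
  is_derive x (1 : R) f df -> is_derive x (1 : R) g dg ->
  is_derive x (1 : R) (fun y => f y * g y) (f x * dg + g x * df).
Proof. by move=> hf hg; exact: (is_deriveM hf hg). Qed.

Lemma is_derive_addr (f g : R -> R) x (df dg : R) :
  is_derive x (1 : R) f df -> is_derive x (1 : R) g dg ->
  is_derive x (1 : R) (fun y => f y + g y) (df + dg).
Proof. by move=> hf hg; exact: (is_deriveD hf hg). Qed.

Lemma is_derive_scale (k : R) x : is_derive x (1 : R) (fun y => k * y) k.
Proof.
have h := is_derive_mulr (is_derive_cst k x (1 : R)) (is_derive_id x (1 : R)).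
by apply: is_derive_eq h _; rewrite /= mulr1 mulr0 addr0.
Qed.

Lemma is_derive_comp_scale (f : R -> R) (k x df : R) :
  is_derive (k * x) (1 : R) f df -> is_derive x (1 : R) (fun y => f (k * y)) (k * df).
Proof.
by move=> hf; rewrite mulrC; exact: (is_derive1_comp hf (is_derive_scale k x)).
Qed.

(** An antiderivative of exp(-cx) (1 + cos(bx)) that vanishes at infinity. *)
Let prim c b x : R := - c^-1 * expR (- (c * x)) +
  (c ^+ 2 + b ^+ 2)^-1 * (expR (- (c * x)) * (b * sin (b * x) - c * cos (b * x))).

Let is_derive_prim c b x : 0 < c ->
  is_derive x (1 : R) (prim c b) (expR (- (c * x)) * (1 + cos (b * x))).
Proof.
move=> c0; have h0 : c ^+ 2 + b ^+ 2 != 0.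
  by rewrite gt_eqF// ltr_pwDl ?exprn_gt0// sqr_ge0.
have c00 : c != 0 by rewrite gt_eqF.
have e1 := is_derive_comp_scale (is_derive_expR (- c * x)).
have s1 := is_derive_comp_scale (is_derive_sin (b * x)).
have c1 := is_derive_comp_scale (is_derive_cos (b * x)).
have k1 (k : R) : is_derive x (1 : R) (fun _ : R => k) (0 : R).
  exact: is_derive_cst.
have h := is_derive_addr (is_derive_mulr (k1 (- c^-1)) e1)
  (is_derive_mulr (k1 (c ^+ 2 + b ^+ 2)^-1) (is_derive_mulr e1
  (is_derive_addr (is_derive_mulr (k1 b) s1) (is_derive_mulr (k1 (- c)) c1)))).
have -> : prim c b = (fun y => - c^-1 * expR (- c * y) +
   (c ^+ 2 + b ^+ 2)^-1 * (expR (- c * y) * (b * sin (b * y) + - c * cos (b * y)))).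
  by apply/funext => y; rewrite /prim !mulNr.
apply: (is_derive_eq h); rewrite /= !mulr0 !mulNr !addr0. field.
by rewrite c00 h0.
Qed.

Let cvg_prim c b : 0 < c -> prim c b x @[x --> +oo] --> 0.
Proof.
move=> c0; pose K := c^-1 + (c ^+ 2 + b ^+ 2)^-1 * (`|b| + c).
have K0 : 0 < K.
  rewrite ltr_pwDl ?invr_gt0// mulr_ge0 ?invr_ge0 ?addr_ge0 ?sqr_ge0//; exact: ltW.
have bnd x : `|prim c b x| <= K * expR (- (c * x)).
  rewrite /prim (le_trans (ler_normD _ _))// mulrDl !normrM normrN lerD//.
    by rewrite !ger0_norm ?invr_ge0 ?expR_ge0 ?(ltW c0).
  rewrite -!mulrA ler_pM ?mulr_ge0 ?normr_ge0//.
    by rewrite ger0_norm// invr_ge0 addr_ge0 ?sqr_ge0.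
  rewrite mulrC (ger0_norm (expR_ge0 _)) ler_wpM2r ?expR_ge0//.
  rewrite (le_trans (ler_normB _ _))// !normrM lerD//.
    by rewrite ler_piMr// ler_norml sin_geN1 sin_le1.
  by rewrite [`|c|]ger0_norm ?(ltW c0)// ler_piMr ?(ltW c0)// ler_norml cos_geN1 cos_le1.
apply/cvgrPdist_lt => e e0; near=> x; rewrite sub0r normrN.
apply: (le_lt_trans (bnd x)).
have x0 : K / (c * e) < x by near: x; apply: nbhs_pinfty_gt; exact: num_real.
have Ke : K / e < c * x.
  move: x0; rewrite ltr_pdivrMr ?mulr_gt0// ltr_pdivrMr//; congr (_ < _); ring.
rewrite expRN ltr_pdivrMr ?expR_gt0// mulrC.
have := expR_ge1Dx (c * x); move: Ke; rewrite ltr_pdivrMr//.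
move=> h1 h2; apply: (lt_le_trans h1); rewrite ler_wpM2r ?(ltW e0)//; lra.
Unshelve. all: by end_near. Qed.

(** Adding 1 to the cosine makes the integrand non-negative, so that the
    fundamental theorem of calculus applies on the half-line without any
    integrability discussion. *)
Lemma integral_abel_cos1 c b : 0 < c ->
  (\int[mu]_x (abel c x * (1 + cos (b * x)))%:E =
   (2 / c + 2 * c / (c ^+ 2 + b ^+ 2))%:E)%E.
Proof.
move=> c0.
have cont1 : continuous (fun x => 1 + cos (b * x)).
  move=> x; apply: cvgD; first exact: cvg_cst.
  exact/continuous_scale/continuous_cos.
pose f x := abel c x * (1 + cos (b * x)).
have f0 x : 0 <= f x.
  by rewrite mulr_ge0 ?abel_ge0//; have := cos_geN1 (b * x); lra.
have cf : continuous f.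
  by move=> x; apply: cvgM; [exact: continuous_abel|exact: cont1].
have even : f =1 f \o -%R by move=> x; rewrite /f /= /abel normrN mulrN cosN.
rewrite (ge0_symfun_integralT f0 cf even) -set_itvcy.
have -> : (\int[mu]_(x in `[0%R, +oo[) (f x)%:E =
    \int[mu]_(x in `[0%R, +oo[) (expR (- (c * x)) * (1 + cos (b * x)))%:E)%E.
  apply: eq_integral => x; rewrite inE /= in_itv/= andbT => x0.
  by rewrite /f /abel ger0_norm.
rewrite (@ge0_continuous_FTC2y _ _ (prim c b) _ 0)//=.
- rewrite -EFinB -EFinM; congr _%:E.
  rewrite /prim !mulr0 oppr0 expR0 sin0 cos0 mulr0 !mulr1 mul1r.
  have h0 : c ^+ 2 + b ^+ 2 != 0.
    by rewrite gt_eqF// ltr_pwDl ?exprn_gt0// sqr_ge0.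
  by field; rewrite h0 gt_eqF.
- apply: continuous_subspaceT => x.
  apply: cvgM; last exact: cont1.
  apply: (@continuous_comp _ _ _ (fun x : R => - (c * x)) expR).
    by apply: cvgN; apply: cvgM; [exact: cvg_cst|exact: cvg_id].
  exact: continuous_expR.
- exact: cvg_prim.
- apply: cvg_at_right_filter.
  apply/differentiable_continuous/derivable1_diffP.
  by have [] := @is_derive_prim c b 0 c0.
- by move=> x _; rewrite derive1E; have [_ ->] := @is_derive_prim c b x c0.
Qed.

Lemma measurable_abel c : measurable_fun setT (abel c).
Proof. exact: (continuous_measurable_fun (@continuous_abel c)). Qed.

Lemma integral_abel c : 0 < c -> (\int[mu]_x (abel c x)%:E = (2 / c)%:E)%E.
Proof.
move=> c0; have := @integral_abel_cos1 c 0 c0.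
have -> : (\int[mu]_x (abel c x)%:E =
    \int[mu]_x (2^-1%:E * (abel c x * (1 + cos (0 * x)))%:E))%E.
  by apply: eq_integral => x _; rewrite mul0r cos0 -EFinM; congr _%:E; field.
rewrite ge0_integralZl//.
- by move=> ->; rewrite -EFinM; congr _%:E; field; rewrite gt_eqF.
- apply/measurable_EFinP; apply: measurable_funM; first exact: measurable_abel.
  apply: measurable_funD => //.
  exact: (continuous_measurable_fun (continuous_scale (@continuous_cos R))).
- by move=> x _; rewrite mul0r cos0 lee_fin mulr_ge0 ?abel_ge0.
Qed.

Lemma rintegrable_abel c : 0 < c -> rintegrable (abel c).
Proof.
move=> c0; apply/integrableP; split.
  apply/measurable_EFinP; exact: (continuous_measurable_fun (@continuous_abel c)).
under eq_integral => x _ do rewrite /= ger0_norm ?abel_ge0//.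
by rewrite integral_abel// ltry.
Qed.

Lemma Rintegral_abel_cos c b : 0 < c ->
  \int[mu]_x (abel c x * cos (b * x)) = 2 * c / (c ^+ 2 + b ^+ 2).
Proof.
move=> c0.
have mcos : measurable_fun setT (fun x : R => cos (b * x)).
  exact: (continuous_measurable_fun (continuous_scale (@continuous_cos R))).
have ic : rintegrable (fun x => abel c x * cos (b * x)).
  apply: (rintegrable_le _ (rintegrable_abel c0)) => [|x].
    by apply: measurable_funM => //; exact: measurable_abel.
  rewrite normrM (ger0_norm (abel_ge0 _ _)) ler_piMr ?abel_ge0//.
  by rewrite ler_norml cos_geN1 cos_le1.
have := RintegralD measurableT (rintegrable_abel c0) ic.
rewrite /Rintegral integral_abel//=.
under eq_integral => x _ do rewrite -{1}(mulr1 (abel c x)) -mulrDr.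
by rewrite integral_abel_cos1//= => /addrI <-.
Qed.

Lemma Rintegral_abel_sin c b : 0 < c ->
  \int[mu]_x (abel c x * sin (b * x)) = 0.
Proof.
move=> c0.
have msin : measurable_fun setT (fun x : R => sin (b * x)).
  exact: (continuous_measurable_fun (continuous_scale (@continuous_sin R))).
have mf : measurable_fun setT (fun x => abel c x * sin (b * x)).
  by apply: measurable_funM => //; exact: measurable_abel.
have isin : rintegrable (fun x => abel c x * sin (b * x)).
  apply: (rintegrable_le mf (rintegrable_abel c0)) => x.
  rewrite normrM (ger0_norm (abel_ge0 _ _)) ler_piMr ?abel_ge0//.
  by rewrite ler_norml sin_geN1 sin_le1.
have N1 : (-1 : R) != 0 by rewrite oppr_eq0 oner_eq0.
have := Rintegral_affine 0 N1 mf.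
rewrite normrN1 mul1r.
rewrite [X in _ = X -> _](_ : _ =
    \int[mu]_x (-1 * (abel c x * sin (b * x)))); last first.
  apply: eq_Rintegral => x _.
  by rewrite add0r !mulN1r /abel normrN mulrN sinN mulrN.
rewrite RintegralZl// => E; lra.
Qed.

Lemma fourier_abel c y : 0 < c ->
  fourier (fun x => (abel c x)%:C) y = (2 * c / (c ^+ 2 + (2 * pi * y) ^+ 2))%:C.
Proof.
move=> c0; apply: complex_ext; rewrite [RHS]/=.
  rewrite -Rintegral_abel_cos//; apply: eq_Rintegral => x _.
  by rewrite Re_mul /= mul0r subr0 mulrN cosN mulrA mulrAC.
rewrite -[RHS](Rintegral_abel_sin (- (2 * pi * y)) c0); apply: eq_Rintegral => x _.
by rewrite Im_mul /= mul0r addr0 mulrN mulNr mulrA mulrAC.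
Qed.

End poisson_kernel.

(** * Fourier inversion *)

Section dominated_convergence.
Context (R : realType).
Local Notation mu := (@lebesgue_measure R).
Local Notation Re := (@complex.Re R).
Local Notation Im := (@complex.Im R).
Local Notation normc := (@Normc.normc R).

Lemma Rintegral_dominated_cvg (h_ : nat -> R -> R) (h k : R -> R) :
  (forall n, measurable_fun setT (h_ n)) -> rintegrable k ->
  (forall n x, `|h_ n x| <= k x) -> (forall x, h_ n x @[n --> \oo] --> h x) ->
  \int[mu]_x h_ n x @[n --> \oo] --> \int[mu]_x h x.
Proof.
move=> mh ik hk hh.
have mh' : measurable_fun setT h.
  exact: (measurable_fun_cvg mh (fun x _ => hh x)).
have [] := @dominated_convergence _ _ R mu setT measurableT
  (fun n => EFin \o h_ n) (EFin \o h) (EFin \o k).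
- by move=> n; apply/measurable_EFinP; exact: mh.
- exact/measurable_EFinP.
- by apply: aeW => x _; apply: cvg_EFin; [exact: nearW|exact: hh].
- exact: ik.
- by apply: aeW => x n _ /=; rewrite lee_fin; exact: hk.
move=> ih _ H.
have E : (\int[mu]_x (EFin \o h) x)%E = (\int[mu]_x h x)%:E by exact: rintegrableE.
move: H; rewrite E => /fine_cvg; exact.
Qed.

Definition ccvg (z : nat -> R[i]) (l : R[i]) :=
  (Re (z n) @[n --> \oo] --> Re l) /\ (Im (z n) @[n --> \oo] --> Im l).

Lemma ccvg_unique z l l' : ccvg z l -> ccvg z l' -> l = l'.
Proof.
move=> [r1 i1] [r2 i2]; apply: complex_ext.
  exact: (cvg_unique _ r1 r2).
exact: (cvg_unique _ i1 i2).
Qed.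

Lemma ccvgMr z l (c : R[i]) : ccvg z l -> ccvg (fun n => c * z n) (c * l).
Proof.
move=> [r i]; split.
  under eq_fun do rewrite Re_mul.
  by rewrite Re_mul; apply: cvgB; apply: cvgM => //; exact: cvg_cst.
under eq_fun do rewrite Im_mul.
by rewrite Im_mul; apply: cvgD; apply: cvgM => //; exact: cvg_cst.
Qed.

Lemma cintegral_dominated_cvg (F_ : nat -> R -> R[i]) (F : R -> R[i]) (k : R -> R) :
  (forall n, cmeasurable (F_ n)) -> rintegrable k -> (forall n x, normc (F_ n x) <= k x) ->
  (forall x, ccvg (fun n => F_ n x) (F x)) ->
  ccvg (fun n => cintegral (F_ n)) (cintegral F).
Proof.
move=> mF ik Fk FF; split => /=.
  apply: (Rintegral_dominated_cvg (k := k)) => //.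
  - by move=> n; have [] := mF n.
  - by move=> n x; exact: le_trans (normr_Re_le _) (Fk n x).
  - by move=> x; have [] := FF x.
apply: (Rintegral_dominated_cvg (k := k)) => //.
- by move=> n; have [] := mF n.
- by move=> n x; exact: le_trans (normr_Im_le _) (Fk n x).
- by move=> x; have [] := FF x.
Qed.

End dominated_convergence.

Section inversion.
Context (R : realType).
Local Notation mu := (@lebesgue_measure R).
Local Notation Re := (@complex.Re R).
Local Notation Im := (@complex.Im R).
Local Notation normc := (@Normc.normc R).
Implicit Types f g : R -> R[i].

Definition ccontinuous f := continuous (fun x => Re (f x)) /\ continuous (fun x => Im (f x)).

Lemma fourier_multiplication f g : cintegrable f -> cintegrable g ->
  cintegral (fun s => g s * fourier f s) = cintegral (fun t => f t * fourier g t).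
Proof.
move=> cf cg; have := multiplication_formula (-1) cg cf.
rewrite /fourier => E; transitivity (cintegral (fun s => g s *
    cintegral (fun t => f t * e2pii (-1 * (s * t))))).
  congr cintegral; apply/funext => s; congr (_ * cintegral _).
  by apply/funext => t; rewrite mulN1r [s * t]mulrC.
rewrite E; congr cintegral; apply/funext => t; congr (_ * cintegral _).
by apply/funext => s; rewrite mulN1r.
Qed.

Let eps (n : nat) : R := n.+1%:R^-1.

Let eps_gt0 n : 0 < eps n. Proof. by rewrite invr_gt0. Qed.

Let cvg_eps : eps n @[n --> \oo] --> 0. Proof. exact: cvg_harmonic. Qed.

Let cintegrable_abel n : cintegrable (fun x => (abel (eps n) x)%:C).
Proof.
apply: (@cintegrable_le _ _ (abel (eps n))); last 1 first.
- by move=> x /=; rewrite expr0n/= addr0 sqrtr_sqr ger0_norm ?abel_ge0.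
- split; last exact: measurable_cst.
  exact: measurable_abel.
- exact: rintegrable_abel.
Qed.

(** The substitution t = (eps n) z / (2 pi) turns the Fourier transform of the Abel
    factor into the fixed weight [wt]. *)
Let approx_identity f n : cintegrable f ->
  cintegral (fun t => f t * fourier (fun x => (abel (eps n) x)%:C) t) =
  (pi^-1)%:C * cintegral (fun z => f (eps n / (2 * pi) * z) * (wt z)%:C).
Proof.
move=> cf; set e := eps n; have e0 : 0 < e by exact: eps_gt0.
have pi0 : 0 < pi :> R := pi_gt0 R.
have d0 : e / (2 * pi) != 0 by rewrite gt_eqF// divr_gt0// mulr_gt0.
pose K y : R := 2 * e / (e ^+ 2 + (2 * pi * y) ^+ 2).
have Kpos y : 0 < e ^+ 2 + (2 * pi * y) ^+ 2.
  by rewrite ltr_pwDl ?exprn_gt0// sqr_ge0.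
have -> : fourier (fun x => (abel e x)%:C) = (fun y => (K y)%:C).
  by apply/funext => y; exact: fourier_abel.
have mK : cmeasurable (fun y => (K y)%:C).
  split; last exact: measurable_cst.
  apply: (continuous_measurable_fun (f := K)) => x.
  apply: cvgM; first exact: cvg_cst.
  apply: cvgV; first by rewrite gt_eqF.
  apply: cvgD; first exact: cvg_cst.
  by apply: cvgM; apply: cvgM; [exact: cvg_cst|exact: cvg_id|exact: cvg_cst|exact: cvg_id].
rewrite (cintegral_affine 0 d0); last by apply: cmeasurableM => //; exact: cintegrable_meas.
have im : cintegrable (fun z => f (e / (2 * pi) * z) * (wt z)%:C).
  apply: (cintegrable_mul_bounded (M := 1)).
  - by have := cintegrable_affine 0 d0 cf; congr cintegrable; apply/funext => x; rewrite add0r.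
  - by split; [exact: measurable_wt|exact: measurable_cst].
  - by move=> x /=; rewrite expr0n/= addr0 sqrtr_sqr ger0_norm ?wt_ge0 ?wt_le1.
rewrite (_ : (fun x => _) = (fun z => (2 / e)%:C * (f (e / (2 * pi) * z) * (wt z)%:C))).
  rewrite cintegralZl// mulrA -rmorphM; congr (_%:C * _).
  rewrite ger0_norm ?divr_ge0 ?mulr_ge0 ?(ltW e0) ?(ltW pi0)//.
  by move: (@pi R) (pi_gt0 R) => p p0; field; rewrite (gt_eqF e0) (gt_eqF p0).
apply/funext => z; rewrite add0r mulrCA; congr (_ * _); rewrite -rmorphM; congr _%:C.
rewrite /K /wt (_ : 2 * pi * (e / (2 * pi) * z) = e * z); last first.
  by move: (@pi R) (pi_gt0 R) => p p0; field; rewrite (gt_eqF p0).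
have : 1 + z ^+ 2 != 0 by rewrite gt_eqF// ltr_pwDl// sqr_ge0.
move=> z0; field; rewrite z0 (gt_eqF e0) /=.
by rewrite exprMn -[X in X + _]mulr1 -mulrDr mulf_neq0// expf_neq0// gt_eqF.
Qed.

(** Insert the factor exp(-|s|/(n+1)) in the integral of the Fourier transform.
    By the multiplication formula this equals the average of f against a Poisson
    kernel concentrating at 0.  Dominated convergence gives the two limits. *)
Lemma fourier_inversion0 f (M : R) : ccontinuous f -> (forall x, normc (f x) <= M) ->
  cintegrable f -> cintegrable (fourier f) -> f 0 = cintegral (fourier f).
Proof.
move=> [c1 c2] fM cf cff.
have mf := cintegrable_meas cf.
pose L n := cintegral (fun s => (abel (eps n) s)%:C * fourier f s).
apply: (@ccvg_unique _ L); last first.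
  apply: (cintegral_dominated_cvg (k := fun x => normc (fourier f x))).
  - move=> n; apply: cmeasurableM; last exact: cintegrable_meas.
    exact: cintegrable_meas.
  - exact: cintegrable_normc.
  - move=> n x; rewrite normcM ler_piMl ?normc_ge0//=.
    by rewrite expr0n/= addr0 sqrtr_sqr ger0_norm ?abel_ge0 ?abel_le1.
  - move=> x; under [X in ccvg X]eq_fun do rewrite mulrC.
    rewrite -[X in ccvg _ X]mulr1; apply: ccvgMr; split => /=; last exact: cvg_cst.
    rewrite -expR0; apply: continuous_cvg; first exact: continuous_expR.
    rewrite -oppr0; apply: cvgN; rewrite -(mul0r `|x|).
    by apply: cvgM => //; exact: cvg_cst.
have -> : L = (fun n => (pi^-1)%:C *
    cintegral (fun z => f (eps n / (2 * pi) * z) * (wt z)%:C)).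
  by apply/funext => n; rewrite /L fourier_multiplication// approx_identity.
have cw : cintegrable (fun z => (wt z)%:C).
  split; last exact: (integrable0 _).
  exact: rintegrable_wt.
have -> : f 0 = (pi^-1)%:C * cintegral (fun z => f 0 * (wt z)%:C).
  rewrite cintegralZl// mulrCA -[LHS]mulr1; congr (_ * _).
  rewrite [cintegral _](_ : _ = pi%:C).
    by rewrite -rmorphM mulVf ?rmorph1// gt_eqF// pi_gt0.
  by apply: complex_ext => /=; rewrite ?Rintegral_wt ?Rintegral_cst ?mul0r.
apply: ccvgMr; apply: (cintegral_dominated_cvg (k := fun x => M * wt x)).
- move=> n; apply: cmeasurableM.
    apply: cmeasurable_comp mf _; exact: measurable_funM.
  by split; [exact: measurable_wt|exact: measurable_cst].
- exact/rintegrableZl/rintegrable_wt.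
- move=> n x; rewrite normcM ler_pM ?normc_ge0//=.
  by rewrite expr0n/= addr0 sqrtr_sqr ger0_norm ?wt_ge0.
- move=> x; rewrite [f 0 * _]mulrC.
  rewrite (_ : (fun n => _) = (fun n => (wt x)%:C * f (eps n / (2 * pi) * x))).
    apply: ccvgMr.
    have lim0 : eps n / (2 * pi) * x @[n --> \oo] --> (0 : R).
      rewrite -[X in _ --> X](mul0r ((2 * pi)^-1 * x)).
      under eq_fun do rewrite -mulrA.
      by apply: cvgM => //; exact: cvg_cst.
    split; first exact: (cvg_comp _ _ lim0 (c1 0)).
    exact: (cvg_comp _ _ lim0 (c2 0)).
  by apply/funext => n; rewrite mulrC.
Qed.

(** Translating f by x multiplies its Fourier transform by e(x xi). *)
Lemma fourier_inversion f (M : R) x : ccontinuous f -> (forall x, normc (f x) <= M) ->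
  cintegrable f -> cintegrable (fourier f) ->
  f x = cintegral (fun xi => fourier f xi * e2pii (x * xi)).
Proof.
move=> [c1 c2] fM cf cff.
pose g y := f (x + y).
have cg : cintegrable g.
  by have := cintegrable_affine x (oner_neq0 R) cf; rewrite /g; under eq_fun do rewrite mul1r.
have fg xi : fourier g xi = fourier f xi * e2pii (x * xi).
  rewrite /fourier [in RHS](cintegral_translate x); last first.
    by apply: cmeasurableM (cintegrable_meas cf) _; apply: cmeasurable_e2pii; apply: measurableT_comp => //; apply: measurable_funM.
  rewrite -cintegralZr.
    congr cintegral; apply/funext => y; rewrite -mulrA -e2piiD; congr (_ * e2pii _).
    by ring.
  apply: cintegrable_e2pii cg _; apply: measurableT_comp => //; apply: measurable_funM => //.
  exact: measurable_funD.
rewrite -[x in LHS]addr0 -/(g 0) (@fourier_inversion0 g M)//.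
- by congr cintegral; apply/funext => xi.
- split => y.
    apply: (@continuous_comp _ _ _ (fun y => x + y) (fun y => Re (f y))); last exact: c1.
    by apply: cvgD; [exact: cvg_cst|exact: cvg_id].
  apply: (@continuous_comp _ _ _ (fun y => x + y) (fun y => Im (f y))); last exact: c2.
  by apply: cvgD; [exact: cvg_cst|exact: cvg_id].
- by move=> y; exact: fM.
- rewrite (_ : fourier g = fun xi => fourier f xi * e2pii (x * xi)); last exact/funext.
  by apply: cintegrable_e2pii cff _; apply: measurable_funM.
Qed.

End inversion.

(** * Fourier transforms of Schwartz functions *)

Section schwartz_real.
Context (R : realType).
Local Notation mu := (@lebesgue_measure R).
Implicit Types u : R -> R.

(** Satisfied by the real and imaginary parts of a Schwartz function. *)
Definition rschwartz u :=
  (forall (n : nat) (x : R), derivable (derive1n n u) x 1) /\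
  forall k n : nat, exists M : R, forall x : R, `|x| ^+ k * `|derive1n n u x| <= M.

Lemma rschwartz_derive u : rschwartz u -> rschwartz (derive1 u).
Proof.
have E n : derive1n n (derive1 u) = derive1n n.+1 u by rewrite /derive1n iterSr.
move=> [du bu]; split=> [n x|k n]; first by rewrite E; exact: du.
by rewrite E; exact: bu.
Qed.

Lemma rschwartz_is_derive u x : rschwartz u -> is_derive x (1 : R) u (derive1 u x).
Proof. by move=> [du _]; rewrite derive1E; apply: DeriveDef => //; exact: (du 0%N x). Qed.

Lemma rschwartz_continuous u : rschwartz u -> continuous u.
Proof.
by move=> [du _] x; apply/differentiable_continuous/derivable1_diffP; exact: (du 0%N x).
Qed.

Lemma rschwartz_wt u : rschwartz u -> exists M : R, forall x, `|u x| <= M * wt x.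
Proof.
move=> [_ bu]; have [M0 H0] := bu 0%N 0%N; have [M2 H2] := bu 2%N 0%N.
exists (M0 + M2) => x; rewrite /wt ler_pdivlMr ?ltr_pwDl ?sqr_ge0//.
rewrite mulrDr mulr1 lerD//; first by have := H0 x; rewrite expr0 mul1r.
by have := H2 x; rewrite real_normK ?num_real// mulrC.
Qed.

Lemma rschwartz_rintegrable u : rschwartz u -> rintegrable u.
Proof.
move=> su; have [M uM] := rschwartz_wt su.
apply: (rintegrable_le _ (rintegrableZl M (rintegrable_wt R)) uM).
exact: (continuous_measurable_fun (rschwartz_continuous su)).
Qed.

(** The integral over [-n, n] is H(n) - H(-n), which tends to 0. *)
Lemma Rintegral_derive_eq0 (H h : R -> R) (M : R) :
  (forall x, is_derive x (1 : R) H (h x)) -> continuous h -> rintegrable h ->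
  (forall x, `|H x| <= M * wt x) -> \int[mu]_x h x = 0.
Proof.
move=> dH ch ih HM.
have cH : continuous H.
  move=> x; apply/differentiable_continuous/derivable1_diffP.
  by have [] := dH x.
pose I_ n : set R := `[(- n.+1%:R), n.+1%:R]%classic.
pose h_ n x := h x * \1_(I_ n) x.
have E n : \int[mu]_x h_ n x = H n.+1%:R - H (- n.+1%:R).
  have lt_n : (- n.+1%:R < n.+1%:R :> R) by rewrite gtrN ?ltr0n.
  have -> : h_ n = h \_ (I_ n).
    apply/funext => x; rewrite /h_ patchE indicE.
    by case: (x \in I_ n); rewrite ?mulr1 ?mulr0.
  rewrite -Rintegral_mkcond /Rintegral (@continuous_FTC2 _ _ H)//.
  - exact: continuous_subspaceT.
  - split.
    + by move=> x _; have [] := dH x.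
    + by apply: cvg_at_right_filter; exact: cH.
    + by apply: cvg_at_left_filter; exact: cH.
  - by move=> x _; rewrite derive1E; have [_ ->] := dH x.
have lim1 : \int[mu]_x h_ n x @[n --> \oo] --> \int[mu]_x h x.
  apply: (Rintegral_dominated_cvg (k := fun x => `|h x|)).
  - move=> n; apply: measurable_funM; first exact: rintegrable_meas.
    by apply: measurable_indic; exact: measurable_itv.
  - exact: rintegrable_norm.
  - move=> n x; rewrite normrM ler_piMr// indicE.
    by case: (_ \in _); rewrite ?normr1 ?normr0.
  - move=> x; apply: cvg_near_cst.
    near=> n; rewrite /h_ indicE mem_set ?mulr1// /I_ /= in_itv/= -ler_norml.
    near: n; exists (Num.truncn `|x|) => // n /= hn.
    rewrite (le_trans (ltW (truncnS_gt _)))// ler_nat ltnS//.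
have lim2 : \int[mu]_x h_ n x @[n --> \oo] --> 0.
  under eq_fun do rewrite E.
  apply/cvgrPdist_le => e e0; near=> n.
  rewrite sub0r normrN.
  have M0 : 0 <= M.
    by have := le_trans (normr_ge0 _) (HM 0); rewrite pmulr_lge0// wt_gt0.
  have small (x : R) : `|x| = n.+1%:R -> `|H x| <= e / 2.
    move=> xn; rewrite (le_trans (HM x))// /wt ler_pdivrMr; last first.
      by rewrite ltr_pwDl ?sqr_ge0.
    have nbig : M / (e / 2) <= n%:R.
      by near: n; exact: nbhs_infty_ger.
    rewrite ler_pdivrMr ?divr_gt0// in nbig.
    rewrite mulrC; apply: (le_trans nbig).
    apply: ler_wpM2r; first exact/ltW/divr_gt0.
    rewrite -[x ^+ 2]real_normK ?num_real// xn -natr1.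
    by have := ler0n R n; nra.
  rewrite (le_trans (ler_normB _ _))// [e]splitr lerD ?small//.
    by rewrite ger0_norm.
  by rewrite normrN ger0_norm.
exact: (cvg_unique _ lim1 lim2).
Unshelve. all: by end_near. Qed.

Lemma rintegrable_mul_bounded u (v : R -> R) : rintegrable u -> continuous v ->
  (forall x, `|v x| <= 1) -> rintegrable (fun x => u x * v x).
Proof.
move=> iu cv v1; apply: (rintegrable_le _ (rintegrable_norm iu)) => [|x].
  apply: measurable_funM; first exact: rintegrable_meas.
  exact: (continuous_measurable_fun cv).
by rewrite normrM ler_piMr.
Qed.

Let cosb (b : R) : continuous (fun x => cos (b * x)).
Proof. exact: (continuous_scale (@continuous_cos R)). Qed.

Let sinb (b : R) : continuous (fun x => sin (b * x)).
Proof. exact: (continuous_scale (@continuous_sin R)). Qed.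

Let cosb1 (b x : R) : `|cos (b * x)| <= 1.
Proof. by rewrite ler_norml cos_geN1 cos_le1. Qed.

Let sinb1 (b x : R) : `|sin (b * x)| <= 1.
Proof. by rewrite ler_norml sin_geN1 sin_le1. Qed.

Lemma derive_cos_transform u (b : R) : rschwartz u ->
  \int[mu]_x (derive1 u x * cos (b * x)) = b * \int[mu]_x (u x * sin (b * x)).
Proof.
move=> su; have su' := rschwartz_derive su.
have iu := rschwartz_rintegrable su; have iu' := rschwartz_rintegrable su'.
have i1 := rintegrable_mul_bounded iu' (@cosb b) (cosb1 b).
have i2 := rintegrable_mul_bounded iu (@sinb b) (sinb1 b).
have [M uM] := rschwartz_wt su.
apply/eqP; rewrite -subr_eq0 -RintegralZl// -RintegralB//; last exact: rintegrableZl.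
apply/eqP; apply: (@Rintegral_derive_eq0 (fun x => u x * cos (b * x)) _ M).
- move=> x; have := is_derive_mulr (rschwartz_is_derive x su)
    (is_derive_comp_scale (is_derive_cos (b * x))).
  by move=> h; apply: (is_derive_eq h); ring.
- move=> x; apply: cvgB; apply: cvgM; [exact: rschwartz_continuous|exact: cosb|exact: cvg_cst|].
  by apply: cvgM; [exact: rschwartz_continuous|exact: sinb].
- by have := rintegrableD i1 (rintegrableZl (-1) (rintegrableZl b i2)); congr rintegrable; apply/funext => x; ring.
- by move=> x; rewrite normrM (le_trans _ (uM x))// ler_piMr.
Qed.

Lemma derive_sin_transform u (b : R) : rschwartz u ->
  \int[mu]_x (derive1 u x * sin (b * x)) = - b * \int[mu]_x (u x * cos (b * x)).
Proof.
move=> su; have su' := rschwartz_derive su.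
have iu := rschwartz_rintegrable su; have iu' := rschwartz_rintegrable su'.
have i1 := rintegrable_mul_bounded iu' (@sinb b) (sinb1 b).
have i2 := rintegrable_mul_bounded iu (@cosb b) (cosb1 b).
have [M uM] := rschwartz_wt su.
apply/eqP; rewrite -subr_eq0 -RintegralZl// -RintegralB//; last exact: rintegrableZl.
apply/eqP; apply: (@Rintegral_derive_eq0 (fun x => u x * sin (b * x)) _ M).
- move=> x; have := is_derive_mulr (rschwartz_is_derive x su)
    (is_derive_comp_scale (is_derive_sin (b * x))).
  by move=> h; apply: (is_derive_eq h); ring.
- move=> x; apply: cvgB; apply: cvgM; [exact: rschwartz_continuous|exact: sinb|exact: cvg_cst|].
  by apply: cvgM; [exact: rschwartz_continuous|exact: cosb].
- by have := rintegrableD i1 (rintegrableZl (-1) (rintegrableZl (- b) i2)); congr rintegrable; apply/funext => x; ring.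
- by move=> x; rewrite normrM (le_trans _ (uM x))// ler_piMr.
Qed.

(** Each integration by parts trades one factor b for one derivative of u. *)
Lemma trig_transform_decay N u : rschwartz u -> exists M : R, forall b : R,
  `|b| ^+ N * `|\int[mu]_x (u x * cos (b * x))| <= M /\
  `|b| ^+ N * `|\int[mu]_x (u x * sin (b * x))| <= M.
Proof.
elim: N u => [|N IH] u su.
  have iu := rschwartz_rintegrable su.
  exists (\int[mu]_x `|u x|) => b; rewrite expr0 !mul1r.
  split.
    have i1 := rintegrable_mul_bounded iu (@cosb b) (cosb1 b).
    apply: (le_trans (le_normr_Rintegral _ i1)) => //.
    apply: le_Rintegral => //; [exact: rintegrable_norm|exact: rintegrable_norm|].
    by move=> x _; rewrite normrM ler_piMr.
  have i1 := rintegrable_mul_bounded iu (@sinb b) (sinb1 b).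
  apply: (le_trans (le_normr_Rintegral _ i1)) => //.
  apply: le_Rintegral => //; [exact: rintegrable_norm|exact: rintegrable_norm|].
  by move=> x _; rewrite normrM ler_piMr.
have [M H] := IH _ (rschwartz_derive su).
exists M => b; have [h1 h2] := H b; rewrite exprSr -!mulrA -!normrM; split.
  by move: h2; rewrite derive_sin_transform// mulNr normrN.
by move: h1; rewrite derive_cos_transform.
Qed.

End schwartz_real.

Section schwartz_fourier.
Context (R : realType).
Local Notation mu := (@lebesgue_measure R).
Local Notation Re := (@complex.Re R).
Local Notation Im := (@complex.Im R).
Local Notation normc := (@Normc.normc R).
Implicit Types f : R -> R[i].

Lemma schwartz_Re f : schwartz f -> rschwartz (fun x => Re (f x)).
Proof.
move=> [sm bd]; split=> [n x|k n]; first by have [] := sm n x.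
have [M H] := bd k n; exists M => x; apply: le_trans (H x).
by rewrite ler_wpM2l ?exprn_ge0//; exact: (normr_Re_le (cderive n f x)).
Qed.

Lemma schwartz_Im f : schwartz f -> rschwartz (fun x => Im (f x)).
Proof.
move=> [sm bd]; split=> [n x|k n]; first by have [] := sm n x.
have [M H] := bd k n; exists M => x; apply: le_trans (H x).
by rewrite ler_wpM2l ?exprn_ge0//; exact: (normr_Im_le (cderive n f x)).
Qed.

Lemma schwartz_cintegrable f : schwartz f -> cintegrable f.
Proof.
by move=> sf; split; apply: rschwartz_rintegrable; [exact: schwartz_Re|exact: schwartz_Im].
Qed.

Lemma schwartz_ccontinuous f : schwartz f -> ccontinuous f.
Proof.
move=> sf; split; apply: rschwartz_continuous; [exact: schwartz_Re|exact: schwartz_Im].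
Qed.

Lemma schwartz_bounded f : schwartz f -> exists M : R, forall x, normc (f x) <= M.
Proof.
move=> [_ bd]; have [M H] := bd 0%N 0%N; exists M => x.
by have := H x; rewrite expr0 mul1r /cderive /=; case: (f x).
Qed.

Lemma fourier_decay f (N : nat) : schwartz f ->
  exists M : R, forall xi, `|xi| ^+ N * normc (fourier f xi) <= M.
Proof.
move=> sf; have [M1 H1] := trig_transform_decay N (schwartz_Re sf).
have [M2 H2] := trig_transform_decay N (schwartz_Im sf).
have [i1 i2] := schwartz_cintegrable sf.
exists (M1 + M1 + (M2 + M2)) => xi; pose b := - (2 * pi * xi).
have [h1 h2] := H1 b; have [h3 h4] := H2 b.
have bxi : `|xi| ^+ N <= `|b| ^+ N.
  rewrite lerXn2r ?nnegrE// /b normrN normrM ler_peMl// ger0_norm ?mulr_ge0 ?pi_ge0//.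
  by have := pi_ge2 R; nra.
have cb : continuous (fun x : R => cos (b * x)) by exact: (continuous_scale (@continuous_cos R)).
have sb : continuous (fun x : R => sin (b * x)) by exact: (continuous_scale (@continuous_sin R)).
have cb1 x : `|cos (b * x)| <= 1 by rewrite ler_norml cos_geN1 cos_le1.
have sb1 x : `|sin (b * x)| <= 1 by rewrite ler_norml sin_geN1 sin_le1.
have E1 : Re (fourier f xi) = \int[mu]_x (Re (f x) * cos (b * x)) -
    \int[mu]_x (Im (f x) * sin (b * x)).
  rewrite -RintegralB//; [|exact: rintegrable_mul_bounded|exact: rintegrable_mul_bounded].
  apply: eq_Rintegral => x _; rewrite Re_mul /=.
  by rewrite (_ : 2 * pi * - (x * xi) = b * x)// /b; ring.
have E2 : Im (fourier f xi) = \int[mu]_x (Re (f x) * sin (b * x)) +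
    \int[mu]_x (Im (f x) * cos (b * x)).
  rewrite -RintegralD//; [|exact: rintegrable_mul_bounded|exact: rintegrable_mul_bounded].
  apply: eq_Rintegral => x _; rewrite Im_mul /=.
  by rewrite (_ : 2 * pi * - (x * xi) = b * x)// /b; ring.
apply: (@le_trans _ _ (`|b| ^+ N * normc (fourier f xi))).
  by rewrite ler_wpM2r ?normc_ge0.
apply: (le_trans (ler_wpM2l (exprn_ge0 _ (normr_ge0 _)) (normc_le_add _))).
rewrite E1 E2.
have n1 := ler_normB (\int[mu]_x (Re (f x) * cos (b * x))) (\int[mu]_x (Im (f x) * sin (b * x))).
have n2 := ler_normD (\int[mu]_x (Re (f x) * sin (b * x))) (\int[mu]_x (Im (f x) * cos (b * x))).
have bN : 0 <= `|b| ^+ N by exact: exprn_ge0.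
apply: (le_trans (ler_wpM2l bN (lerD n1 n2))).
by rewrite !mulrDr; lra.
Qed.

(** Fubini's theorem gives measurability of the inner integral of an integrable
    function on the plane; the factor [wt] in xi provides this integrability and
    is divided out afterwards. *)
Lemma fourier_meas f : cintegrable f -> cmeasurable (fourier f).
Proof.
move=> cf.
pose F (z : R * R) := (wt z.1)%:C * f z.2 * e2pii (- (z.2 * z.1)).
have mw : cmeasurable (fun x : R => (wt x)%:C).
  by split; [exact: measurable_wt|exact: measurable_cst].
have mF : cmeasurable F.
  apply: cmeasurableM; first apply: cmeasurableM.
  - exact: (cmeasurable_comp mw measurable_fst).
  - exact: (cmeasurable_comp (cintegrable_meas cf) measurable_snd).
  - apply: cmeasurable_e2pii; apply: measurableT_comp => //.
    exact: (measurable_funM measurable_snd measurable_fst).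
have Fab x y : normc (F (x, y)) <= wt x * normc (f y).
  by rewrite /F /= !normcM normc_e2pii mulr1 /= expr0n/= addr0 sqrtr_sqr ger0_norm ?wt_ge0.
have := cintegrable_meas (cintegrable_fubini1 mF (rintegrable_wt R) (cintegrable_normc cf) Fab).
have -> : (fun x => cintegral (fun y => F (x, y))) = (fun x => (wt x)%:C * fourier f x).
  apply/funext => x; rewrite -cintegralZl; last first.
    by apply: cintegrable_e2pii cf _; apply: measurableT_comp => //; apply: measurable_funM.
  by congr cintegral; apply/funext => y; rewrite /F /= mulrA.
have mw' : cmeasurable (fun x : R => ((wt x)^-1)%:C).
  split; last exact: measurable_cst.
  rewrite /= /wt; under eq_fun do rewrite invrK.
  by apply: measurable_funD => //; exact: measurable_funX.
move=> /(cmeasurableM mw'); congr cmeasurable; apply/funext => x.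
by rewrite mulrA -rmorphM mulVf ?rmorph1 ?mul1r// gt_eqF// wt_gt0.
Qed.

Lemma schwartz_fourier_cintegrable f : schwartz f -> cintegrable (fourier f).
Proof.
move=> sf; have [M0 H0] := fourier_decay 0 sf; have [M2 H2] := fourier_decay 2 sf.
apply: (cintegrable_le (fourier_meas (schwartz_cintegrable sf)) (rintegrableZl (M0 + M2) (rintegrable_wt R))) => x.
rewrite /wt ler_pdivlMr ?ltr_pwDl ?sqr_ge0// mulrDr mulr1 lerD//.
  by have := H0 x; rewrite expr0 mul1r.
by have := H2 x; rewrite real_normK ?num_real// mulrC.
Qed.

Lemma schwartz_inversion f x : schwartz f ->
  f x = cintegral (fun xi => fourier f xi * e2pii (x * xi)).
Proof.
move=> sf; have [M fM] := schwartz_bounded sf.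
exact: (fourier_inversion x (schwartz_ccontinuous sf) fM (schwartz_cintegrable sf)
  (schwartz_fourier_cintegrable sf)).
Qed.

End schwartz_fourier.

(** * The bilinear multiplier in physical space *)

Section kernel_representation.
Context (R : realType).
Local Notation normc := (@Normc.normc R).
Implicit Types phi f g : R -> R[i].

(** Write phi(xi - eta - a) as the integral of its Fourier transform against
    e((xi - eta - a) t), and exchange t first with xi, then with eta.  What is left
    are the inversion formulas for f at x + t and for g at x - t. *)
Lemma bilinear_multiplierE phi f g (a x : R) :
  schwartz phi -> schwartz f -> schwartz g ->
  bilinear_multiplier (fun xi => phi (xi - a)) f g x =
  fourier (fun t => fourier phi t * f (x + t) * g (x - t)) a.
Proof.
move=> sphi sf sg.
have cphi := schwartz_cintegrable sphi.
have [Mf fM] := schwartz_bounded sf.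
have [Mphi phiM] := schwartz_bounded sphi.
have ck := schwartz_fourier_cintegrable sphi.
have cf := schwartz_fourier_cintegrable sf.
have cg := schwartz_fourier_cintegrable sg.
pose A xi := fourier f xi * e2pii (x * xi).
have cA : cintegrable A by apply: cintegrable_e2pii cf _; exact: measurable_funM.
have mft : cmeasurable (fun t => f (x + t)).
  by apply: (cmeasurable_comp (cintegrable_meas (schwartz_cintegrable sf))); exact: measurable_funD.
pose B eta t := fourier phi t * e2pii (- ((eta + a) * t)).
have cB eta : cintegrable (B eta).
  by apply: cintegrable_e2pii ck _; apply: measurableT_comp => //; exact: measurable_funM.
have inner eta : cintegral (fun xi => fourier f xi * fourier g eta *
    phi (xi - eta - a) * e2pii (x * (xi + eta))) =
    (fourier g eta * e2pii (x * eta)) *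
    cintegral (fun t => fourier phi t * f (x + t) * e2pii (- (a * t)) *
      e2pii (-1 * (eta * t))).
  transitivity ((fourier g eta * e2pii (x * eta)) *
      cintegral (fun xi => A xi * phi (xi - eta - a))).
    rewrite -cintegralZl.
      congr cintegral; apply/funext => xi; rewrite mulrDr e2piiD /A.
      by move: (fourier f _) (fourier g _) (phi _) (e2pii (x * xi)) (e2pii _) => u v w y z; ring.
    apply: (cintegrable_mul_bounded (M := Mphi) cA) => [|xi]; last exact: phiM.
    apply: (cmeasurable_comp (cintegrable_meas cphi)).
    by apply: measurable_funB => //; exact: measurable_funB.
  congr (_ * _).
  transitivity (cintegral (fun xi => A xi *
      cintegral (fun t => B eta t * e2pii (1 * (xi * t))))).
    congr cintegral; apply/funext => xi; congr (_ * _).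
    rewrite (schwartz_inversion _ sphi); congr cintegral; apply/funext => t.
    by rewrite /B -mulrA -e2piiD; congr (_ * e2pii _); ring.
  rewrite (multiplication_formula 1 cA (cB eta)); congr cintegral; apply/funext => t.
  rewrite (_ : cintegral _ = f (x + t)).
    rewrite /B -!mulrA; congr (_ * _); rewrite mulrC; congr (_ * _).
    by rewrite -e2piiD; congr e2pii; ring.
  rewrite (schwartz_inversion _ sf); congr cintegral; apply/funext => xi.
  by rewrite /A -mulrA -e2piiD; congr (_ * e2pii _); ring.
rewrite /bilinear_multiplier; under eq_fun do rewrite inner.
have cG : cintegrable (fun eta => fourier g eta * e2pii (x * eta)).
  by apply: cintegrable_e2pii cg _; exact: measurable_funM.
have cH : cintegrable (fun t => fourier phi t * f (x + t) * e2pii (- (a * t))).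
  apply: cintegrable_e2pii; last by apply: measurableT_comp => //; exact: measurable_funM.
  by apply: (cintegrable_mul_bounded (M := Mf) ck mft) => t.
rewrite (multiplication_formula (-1) cG cH) /fourier.
congr cintegral; apply/funext => t.
rewrite -!mulrA; congr (_ * (_ * _)); rewrite mulrC; congr (_ * e2pii _); last by ring.
rewrite [RHS](schwartz_inversion _ sg); congr cintegral; apply/funext => eta.
by rewrite -mulrA -e2piiD; congr (_ * e2pii _); ring.
Qed.

End kernel_representation.

(** * A weighted Bessel inequality *)

Section finite_sums.
Context (R : realType).

Lemma sum_geometric_uniq_nat (s : seq nat) : uniq s ->
  \sum_(k <- s) (2^-1 : R) ^+ k <= 2.
Proof.
move=> us; pose L := (\max_(k <- s) k).+1.
have sL k : k \in s -> (k < L)%N.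
  by move=> ks; rewrite ltnS; apply: leq_bigmax_seq.
have ps : perm_eq s [seq k <- iota 0 L | k \in s].
  apply: uniq_perm => //; first by rewrite filter_uniq// iota_uniq.
  move=> k; rewrite mem_filter mem_iota /= add0n andbC.
  by case: (boolP (k \in s)) => [/sL ->//|]; rewrite andbF.
rewrite (perm_big _ ps) big_filter /=.
apply: (@le_trans _ _ (\sum_(k <- iota 0 L) (2^-1 : R) ^+ k)).
  rewrite big_mkcond; apply: ler_sum => k _.
  by case: ifP => // _; rewrite exprn_ge0.
elim: {ps sL} L => [|m IH]; first by rewrite big_nil.
rewrite (_ : iota 0 m.+1 = 0%N :: [seq k.+1 | k <- iota 0 m]); last first.
  by rewrite /= -[1%N]addn0 iotaDl; congr cons; apply: eq_map => k.
rewrite big_cons big_map expr0; under eq_bigr do rewrite exprS.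
rewrite -mulr_sumr; lra.
Qed.

Lemma sum_geometric_uniq (N : seq int) (n : int) : uniq N ->
  \sum_(m <- N) (2^-1 : R) ^+ `|n - m|%N <= 4.
Proof.
move=> uN; rewrite (bigID (fun m : int => (n <= m)%R)) /=.
rewrite -(_ : 2 + 2 = 4 :> R); last by lra.
apply: lerD; rewrite -big_filter.
  rewrite -(big_map (fun m : int => `|n - m|%N) xpredT (fun k => (2^-1 : R) ^+ k)).
  apply: sum_geometric_uniq_nat; rewrite map_inj_in_uniq ?filter_uniq//.
  move=> m m'; rewrite !mem_filter => /andP[h _] /andP[h' _] E; lia.
rewrite -(big_map (fun m : int => `|n - m|%N) xpredT (fun k => (2^-1 : R) ^+ k)).
apply: sum_geometric_uniq_nat; rewrite map_inj_in_uniq ?filter_uniq//.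
move=> m m'; rewrite !mem_filter => /andP[h _] /andP[h' _] E; lia.
Qed.

End finite_sums.

Section weighted_bessel.
Context (R : realType).
Local Notation mu := (@lebesgue_measure R).
Local Notation Re := (@complex.Re R).
Local Notation Im := (@complex.Im R).
Local Notation normc := (@Normc.normc R).

Lemma realcM (a b : R) : (a * b)%:C = a%:C * b%:C :> R[i].
Proof. by apply: complex_ext; rewrite ?Re_mul ?Im_mul /=; ring. Qed.

Lemma Re_mulr_real (z : R[i]) (a : R) : Re (z * a%:C) = Re z * a.
Proof. by rewrite Re_mul /= mulr0 subr0. Qed.

Lemma Re_sum I (s : seq I) (z : I -> R[i]) :
  Re (\sum_(i <- s) z i) = \sum_(i <- s) Re (z i).
Proof. by elim: s => [|i s IH]; rewrite ?big_nil// !big_cons Re_add IH. Qed.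

Lemma normc_sum I (s : seq I) (z : I -> R[i]) :
  normc (\sum_(i <- s) z i) <= \sum_(i <- s) normc (z i).
Proof.
elim: s => [|i s IH]; first by rewrite !big_nil Normc.normc0.
by rewrite !big_cons (le_trans (le_normcD _ _))// lerD2l.
Qed.

Lemma normc_conjc (z : R[i]) : normc (conjc z) = normc z.
Proof. by case: z => a b /=; rewrite sqrrN. Qed.

Lemma conjc_e2pii (t : R) : conjc (e2pii t) = e2pii (- t).
Proof. by rewrite /e2pii /= mulrN cosN sinN. Qed.

Lemma conjcM (z w : R[i]) : conjc (z * w) = conjc z * conjc w.
Proof. by case: z w => [a b] [c d]; apply: complex_ext => /=; ring. Qed.

Lemma conjc_sum I (s : seq I) (z : I -> R[i]) :
  conjc (\sum_(i <- s) z i) = \sum_(i <- s) conjc (z i).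
Proof.
elim: s => [|i s IH]; first by rewrite !big_nil /= oppr0.
by rewrite !big_cons -IH; case: (z i) (\sum_(_ <- _) _) => [a b] [c d]; apply: complex_ext => /=; ring.
Qed.

Lemma sqr_normcE (z : R[i]) : normc z ^+ 2 = Re (z * conjc z).
Proof. by rewrite sqr_normc; case: z => a b /=; ring. Qed.

Lemma cintegrable_sum I (s : seq I) (f : I -> R -> R[i]) : (forall i, cintegrable (f i)) ->
  cintegrable (fun x => \sum_(i <- s) f i x).
Proof.
move=> cf; elim: s => [|i s IH].
  under eq_fun do rewrite big_nil.
  by split; exact: (integrable0 _).
under eq_fun do rewrite big_cons.
have [a1 a2] := cf i; have [b1 b2] := IH.
split; first by under eq_fun do rewrite Re_add; exact: rintegrableD.
by under eq_fun do rewrite Im_add; exact: rintegrableD.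
Qed.

Lemma cintegral_sum I (s : seq I) (f : I -> R -> R[i]) : (forall i, cintegrable (f i)) ->
  cintegral (fun x => \sum_(i <- s) f i x) = \sum_(i <- s) cintegral (f i).
Proof.
move=> cf; elim: s => [|i s IH].
  rewrite big_nil; under eq_fun do rewrite big_nil.
  by apply: complex_ext; rewrite /= Rintegral_cst// mul0r.
under eq_fun do rewrite big_cons.
by rewrite cintegralD// ?IH ?big_cons//; exact: cintegrable_sum.
Qed.

Lemma cintegrable_wt : cintegrable (fun t : R => (wt t)%:C).
Proof.
split; last exact: (integrable0 _).
exact: rintegrable_wt.
Qed.

(** Inversion for the Abel factor: the Fourier transform of the Poisson kernel is
    that factor again. *)
Lemma cintegral_wt_e2pii (s : R) :
  cintegral (fun t => (wt t)%:C * e2pii (s * t)) = (pi * abel (2 * pi) s)%:C.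
Proof.
have pi0 := pi_gt0 R; have c0 : 0 < 2 * pi :> R by rewrite mulr_gt0.
have F (y : R) : fourier (fun x : R => (abel (2 * pi) x)%:C) y = (pi^-1)%:C * (wt y)%:C.
  rewrite (fourier_abel y c0) -realcM; congr _%:C; rewrite /wt.
  have : 1 + y ^+ 2 != 0 by rewrite gt_eqF// ltr_pwDl// sqr_ge0.
  move: (@pi R) pi0 => p p0 y0; field; rewrite y0 (gt_eqF p0)/=.
  rewrite gt_eqF// ltr_pwDl ?sqr_ge0// exprn_gt0// mulr_gt0//.
have cab : cintegrable (fun x : R => (abel (2 * pi) x)%:C).
  by split; [exact: rintegrable_abel|exact: (integrable0 _)].
have ccab : ccontinuous (fun x : R => (abel (2 * pi) x)%:C).
  by split; [exact: continuous_abel|move=> x; exact: cvg_cst].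
have FE : fourier (fun x : R => (abel (2 * pi) x)%:C) = fun y => (pi^-1)%:C * (wt y)%:C.
  exact/funext.
have cF : cintegrable (fourier (fun x : R => (abel (2 * pi) x)%:C)).
  rewrite FE; under eq_fun do rewrite mulrC.
  by apply: (cintegrable_mul_bounded (M := normc (pi^-1)%:C) cintegrable_wt) => //; exact: cmeasurable_cst.
have ab1 (x : R) : normc (abel (2 * pi) x)%:C <= 1.
  by rewrite /= expr0n/= addr0 sqrtr_sqr ger0_norm ?abel_ge0 ?abel_le1.
have := fourier_inversion s ccab ab1 cab cF.
rewrite FE; under eq_fun do rewrite -mulrA.
rewrite cintegralZl; last by apply: cintegrable_e2pii cintegrable_wt _; exact: measurable_funM.
by move=> E; rewrite realcM E mulrA -realcM mulfV ?mul1r// gt_eqF.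
Qed.

Lemma abel_int_le (k : int) : abel (2 * pi) k%:~R <= (2^-1 : R) ^+ `|k|%N.
Proof.
rewrite /abel -intr_norm -abszE.
rewrite (_ : (`|k|%N%:~R : R) = `|k|%N%:R)//.
move: `|k|%N => j; rewrite expRN exprVn lef_pV2 ?posrE ?expR_gt0 ?exprn_gt0//.
rewrite expRM_natr.
rewrite lerXn2r ?nnegrE ?expR_ge0//.
have := expR_ge1Dx (2 * pi : R); have := pi_ge2 R; lra.
Qed.

(** Duality.  Let T n be the values of the Fourier transform of h, D the sum of
    their squared moduli, and Q(t) the sum of conj(T n) e(-nt), so that D is the
    integral of h Q.  The Fourier transform of [wt] at the integers decays
    geometrically, hence the functions e(nt) are almost orthogonal for this weight
    and the integral of |Q|^2 wt is at most 4 pi D.  Cauchy-Schwarz with respect to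
    [wt] then bounds D by the integral of |h|^2 / wt. *)
Lemma weighted_bessel (h : R -> R[i]) (N : seq int) : uniq N -> cintegrable h ->
  rintegrable (fun t => normc (h t) ^+ 2 / wt t) ->
  \sum_(n <- N) normc (fourier h n%:~R) ^+ 2 <=
  4 * pi * \int[mu]_t (normc (h t) ^+ 2 / wt t).
Proof.
move=> uN ch ih2.
pose T (n : int) := fourier h n%:~R.
pose D := \sum_(n <- N) normc (T n) ^+ 2.
pose Q t := \sum_(n <- N) conjc (T n) * e2pii (- (t * n%:~R)).
set X := (\int[mu]_t _).
have me (a : R) : measurable_fun setT (fun t : R => - (t * a)).
  by apply: measurableT_comp => //; exact: measurable_funM.
have che (n : int) : cintegrable (fun t => h t * e2pii (- (t * n%:~R))).
  by apply: cintegrable_e2pii ch _; exact: me.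
pose B := \sum_(n <- N) normc (T n).
have QB t : normc (Q t) <= B.
  apply: (le_trans (normc_sum _ _)); apply: ler_sum => n _.
  by rewrite normcM normc_e2pii mulr1 normc_conjc.
have B0 : 0 <= B by apply: sumr_ge0 => n _; exact: normc_ge0.
have mQ : cmeasurable Q.
  have cw (n : int) : cintegrable (fun t => (wt t)%:C * (conjc (T n) * e2pii (- (t * n%:~R)))).
    apply: (cintegrable_mul_bounded (M := normc (T n)) cintegrable_wt) => [|t].
      by apply: cmeasurableM; [exact: cmeasurable_cst|apply: cmeasurable_e2pii; exact: me].
    by rewrite normcM normc_e2pii mulr1 normc_conjc.
  have := cintegrable_meas (cintegrable_sum N cw).
  have mw' : cmeasurable (fun x : R => ((wt x)^-1)%:C).
    split; last exact: measurable_cst.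
    rewrite /= /wt; under eq_fun do rewrite invrK.
    by apply: measurable_funD => //; exact: measurable_funX.
  move=> /(cmeasurableM mw'); congr cmeasurable; apply/funext => x.
  rewrite -mulr_sumr mulrA -realcM mulVf ?rmorph1 ?mul1r//.
  by rewrite gt_eqF// wt_gt0.
have chQ : cintegrable (fun t => h t * Q t) by exact: (cintegrable_mul_bounded ch mQ QB).
have DE : D = \int[mu]_t Re (h t * Q t).
  rewrite -[RHS]/(Re (cintegral (fun t => h t * Q t))) /Q.
  under eq_fun do rewrite mulr_sumr.
  rewrite cintegral_sum; last first.
    move=> n; have := cintegrable_mul_bounded (che n) (cmeasurable_cst _ (conjc (T n))) (fun _ => lexx _).
    by congr cintegrable; apply/funext => t; ring.
  rewrite Re_sum; apply: eq_bigr => n _; rewrite sqr_normcE -cintegralZr//.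
  by congr (Re (cintegral _)); apply/funext => t; ring.
have iQ2 : rintegrable (fun t => normc (Q t) ^+ 2 * wt t).
  apply: (rintegrable_le _ (rintegrableZl (B ^+ 2) (rintegrable_wt R))) => [|t].
    by apply: measurable_funM; [apply: measurable_funX; exact: cmeasurable_normc|exact: measurable_wt].
  rewrite normrM !ger0_norm ?wt_ge0 ?exprn_ge0 ?normc_ge0//.
  by rewrite ler_wpM2r ?wt_ge0// lerXn2r ?nnegrE ?normc_ge0.
have Y : \int[mu]_t (normc (Q t) ^+ 2 * wt t) <= 4 * pi * D.
  (* expand the square of Q into frequencies m - n *)
  have QQ t : normc (Q t) ^+ 2 * wt t = Re (\sum_(n <- N) \sum_(m <- N)
      (conjc (T n) * T m) * ((wt t)%:C * e2pii ((m - n)%:~R * t))).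
    rewrite sqr_normcE -[LHS]subr0 -[X in _ - X](mulr0 (Im (Q t * conjc (Q t)))).
    rewrite -[wt t]/(Re (wt t)%:C) -[0 in LHS]/(Im (wt t)%:C) -Re_mul.
    congr Re; rewrite /Q conjc_sum mulr_suml mulr_suml.
    apply: eq_bigr => n _; rewrite mulr_sumr mulr_suml; apply: eq_bigr => m _.
    rewrite conjcM conjc_e2pii conjcK.
    rewrite (_ : (m - n)%:~R * t = - (t * n%:~R) - - (t * m%:~R)); last first.
      by rewrite rmorphB /=; ring.
    by rewrite e2piiD; ring.
  have cwe (n m : int) : cintegrable (fun t : R => (wt t)%:C * e2pii ((m - n)%:~R * t)).
    by apply: cintegrable_e2pii cintegrable_wt _; exact: measurable_funM.
  have cc (n m : int) : cintegrable (fun t : R => (conjc (T n) * T m) *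
      ((wt t)%:C * e2pii ((m - n)%:~R * t))).
    have := cintegrable_mul_bounded (cwe n m) (cmeasurable_cst _ (conjc (T n) * T m)) (fun _ => lexx _).
    by congr cintegrable; apply/funext => t; rewrite mulrC.
  under eq_Rintegral do rewrite QQ.
  rewrite -[leLHS]/(Re (cintegral (fun t => \sum_(n <- N) \sum_(m <- N)
      (conjc (T n) * T m) * ((wt t)%:C * e2pii ((m - n)%:~R * t))))).
  rewrite cintegral_sum; last by move=> n; exact: cintegrable_sum.
  rewrite Re_sum.
  apply: (@le_trans _ _ (\sum_(n <- N) \sum_(m <- N)
     pi * (2^-1 * (normc (T n) ^+ 2 + normc (T m) ^+ 2) * 2^-1 ^+ `|n - m|%N))).
    apply: ler_sum => n _; rewrite cintegral_sum// Re_sum; apply: ler_sum => m _.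
    rewrite cintegralZl// cintegral_wt_e2pii Re_mulr_real.
    rewrite mulrCA ler_wpM2l ?pi_ge0//.
    apply: (@le_trans _ _ (normc (T n) * normc (T m) * abel (2 * pi) (m - n)%:~R)).
      rewrite ler_wpM2r ?abel_ge0// (le_trans (ler_norm _))//.
      by rewrite (le_trans (normr_Re_le _))// normcM normc_conjc.
    rewrite ler_pM ?mulr_ge0 ?normc_ge0 ?abel_ge0//.
      have := sqr_ge0 (normc (T n) - normc (T m)); rewrite sqrrB.
      by move: (normc (T n)) (normc (T m)) => u v; lra.
    by rewrite distnC; exact: abel_int_le.
  apply: (@le_trans _ _ (\sum_(n <- N) \sum_(m <- N)
     (pi * (normc (T n) ^+ 2 * 2^-1 ^+ `|n - m|%N)))).
    rewrite le_eqVlt; apply/orP; left; apply/eqP.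
    (* Schur's test: the two halves agree by the symmetry in n and m *)
    have split2 n m : pi * (2^-1 * (normc (T n) ^+ 2 + normc (T m) ^+ 2) * 2^-1 ^+ `|n - m|%N) =
       2^-1 * (pi * (normc (T n) ^+ 2 * 2^-1 ^+ `|n - m|%N)) +
       2^-1 * (pi * (normc (T m) ^+ 2 * 2^-1 ^+ `|m - n|%N)).
      by rewrite [`|m - n|%N]distnC; move: (@pi R) (normc _) (_ ^+ `|_|%N) => p u v; ring.
    under eq_bigr do under eq_bigr do rewrite split2.
    under eq_bigr do rewrite big_split.
    rewrite big_split /= [X in _ + X]exchange_big /=.
    under eq_bigr do rewrite -mulr_sumr.
    rewrite -!mulr_sumr -mulrDl (_ : 2^-1 + 2^-1 = 1 :> R) ?mul1r//; lra.
  rewrite /D mulr_sumr; apply: ler_sum => n _.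
  rewrite -mulr_sumr -mulr_sumr.
  rewrite [leRHS](_ : _ = pi * (normc (T n) ^+ 2 * 4)); last by ring.
  rewrite ler_wpM2l ?pi_ge0// ler_wpM2l ?exprn_ge0 ?normc_ge0//.
  exact: sum_geometric_uniq.
(* Cauchy-Schwarz as |h Q| <= (l/2) |h|^2/wt + |Q|^2 wt/(2 l): the choice
   l = 4 pi leaves D/2 on the right *)
pose l : R := 4 * pi.
have l0 : 0 < l by rewrite mulr_gt0 ?pi_gt0.
have : D <= l / 2 * X + (2 * l)^-1 * \int[mu]_t (normc (Q t) ^+ 2 * wt t).
  rewrite DE -RintegralZl// -RintegralZl// -RintegralD//; [|exact: rintegrableZl|exact: rintegrableZl].
  apply: le_Rintegral => //.
  - by have [] := chQ.
  - by apply: rintegrableD; exact: rintegrableZl.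
  move=> t _; apply: (le_trans (ler_norm _)); apply: (le_trans (normr_Re_le _)).
  rewrite normcM; have w0 := wt_gt0 t.
  move: (normc (h t)) (normc (Q t)) (wt t) w0 => u v w w0.
  have := sqr_ge0 (l * u / w - v).
  move=> H; have {}H : 0 <= (l * u / w - v) ^+ 2 * (w / (2 * l)).
    by rewrite mulr_ge0 ?divr_ge0// ?(ltW w0)// mulr_ge0// ltW.
  rewrite -subr_ge0 (le_trans H)// le_eqVlt; apply/orP; left; apply/eqP.
  by field; rewrite (gt_eqF w0) (gt_eqF l0).
move=> H1; have {H1} : D <= l / 2 * X + (2 * l)^-1 * (l * D).
  rewrite (le_trans H1)// lerD2l ler_wpM2l// invr_ge0 mulr_ge0//; exact: ltW.
rewrite (_ : (2 * l)^-1 * (l * D) = D / 2); last by field; rewrite gt_eqF.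
rewrite -/D -/l; lra.
Qed.

End weighted_bessel.

(** * A bilinear estimate for local averages *)

Section jensen.
Context (R : realType).
Local Notation mu := (@lebesgue_measure R).
Local Open Scope ereal_scope.

(** If u <= l the first term suffices, otherwise the second one does. *)
Lemma poweR_le_linear (q l : R) (u : \bar R) : (0 < q)%R -> (q <= 1)%R -> (0 < l)%R ->
  0 <= u -> u `^ q <= (l `^ q)%:E + (l `^ (q - 1))%:E * u.
Proof.
move=> q0 q1 l0; have lq : (0 < l `^ (q - 1))%R by rewrite powR_gt0.
case: u => [u| |] //; last first.
  move=> _; rewrite poweRyr ?gt_eqF// gt0_muley ?lte_fin//= leey//.
rewrite lee_fin => u0; rewrite poweR_EFin -EFinM -EFinD lee_fin.
have [ul|lu] := leP u l.
  rewrite (@le_trans _ _ (l `^ q)%R)//; last by rewrite lerDl mulr_ge0// ltW.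
  by rewrite ge0_ler_powR ?nnegrE ?(ltW q0) ?(ltW l0).
rewrite (@le_trans _ _ (l `^ (q - 1) * u)%R)//; last by rewrite lerDr powR_ge0.
have up : (0 < u)%R by exact: lt_trans l0 lu.
have -> : (u `^ q = u `^ (q - 1) * u)%R.
  by rewrite -{3}(powRr1 u0) -powRD ?subrK// gt_eqF ?implybT.
rewrite ler_wpM2r// -(opprB 1%R q) !powRN lef_pV2 ?posrE ?powR_gt0//.
by rewrite ge0_ler_powR ?nnegrE ?subr_ge0// ltW.
Qed.

(** Integrate [poweR_le_linear] against v, where l is the integral of U v; if
    l = 0, then U v vanishes almost everywhere.  The constant 1 + W is not sharp. *)
Lemma weighted_jensen (U : R -> \bar R) (v : R -> R) (q W : R) :
  (0 < q)%R -> (q <= 1)%R ->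
  measurable_fun setT U -> (forall x, 0 <= U x) ->
  measurable_fun setT v -> (forall x, (0 <= v x)%R) ->
  \int[mu]_x (v x)%:E <= W%:E ->
  \int[mu]_x (U x `^ q * (v x)%:E) <= (1 + W)%:E * (\int[mu]_x (U x * (v x)%:E)) `^ q.
Proof.
move=> q0 q1 mU U0 mv v0 vW.
have W0 : (0 <= W)%R.
  by rewrite -lee_fin (le_trans _ vW)// integral_ge0// => x _; rewrite lee_fin.
have mvE : measurable_fun setT (EFin \o v) by exact/measurable_EFinP.
have mUv : measurable_fun setT (fun x => U x * (v x)%:E) by exact: emeasurable_funM.
have Uv0 x : 0 <= U x * (v x)%:E by rewrite mule_ge0// lee_fin.
have mUq : measurable_fun setT (fun x => U x `^ q * (v x)%:E).
  apply: emeasurable_funM => //.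
  exact: (measurableT_comp (measurable_poweR q) mU).
have : 0 <= \int[mu]_x (U x * (v x)%:E) by exact: integral_ge0.
case E : (\int[mu]_x (U x * (v x)%:E)) => [l| |] //; last first.
  by move=> _; rewrite poweRyr ?gt_eqF// gt0_muley ?leey// lte_fin ltr_pwDl.
rewrite lee_fin le_eqVlt => /predU1P[l0|l0].
  rewrite -l0 poweR0r ?gt_eqF// mule0.
  have : \int[mu]_x `|U x * (v x)%:E| = 0.
    by rewrite -[RHS]/(0%:E) l0 -E; apply: eq_integral => x _; rewrite gee0_abs.
  move/(ae_eq_integral_abs mu measurableT mUv).1 => aeq.
  rewrite (ae_eq_integral (cst 0)) ?integral0//.
  apply: filterS aeq => x /(_ I) /= /eqP; rewrite mule_eq0 => /orP[/eqP -> _|/eqP ->].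
    by rewrite poweR0r ?gt_eqF// mul0e.
  by rewrite mule0.
have lq : (0 <= l `^ (q - 1))%R by exact: powR_ge0.
apply: (@le_trans _ _ (\int[mu]_x ((l `^ q)%:E * (v x)%:E +
    (l `^ (q - 1))%:E * (U x * (v x)%:E)))).
  apply: ge0_le_integralT => x.
    by rewrite mule_ge0 ?poweR_ge0// lee_fin.
  rewrite muleA -ge0_muleDl ?lee_fin ?powR_ge0//; last by rewrite mule_ge0 ?lee_fin.
  by apply: lee_wpmul2r; rewrite ?lee_fin//; exact: poweR_le_linear.
rewrite ge0_integralD//; last 4 first.
- by move=> x _; rewrite mule_ge0 ?lee_fin ?powR_ge0.
- exact: measurable_funeM.
- by move=> x _; rewrite mule_ge0 ?lee_fin.
- exact: measurable_funeM.
rewrite !ge0_integralZl ?lee_fin ?powR_ge0//; last by move=> x _; rewrite lee_fin.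
rewrite E poweR_EFin -!EFinM addrC mulrDl mul1r EFinD.
have -> : (l `^ (q - 1) * l = l `^ q)%R.
  by rewrite -{2}(powRr1 (ltW l0)) -powRD ?subrK// gt_eqF ?implybT.
rewrite leeD2l// muleC EFinM lee_wpmul2r ?lee_fin ?powR_ge0//.
Qed.

End jensen.

Section bilinear_average.
Context (R : realType).
Local Notation mu := (@lebesgue_measure R).
Local Open Scope ereal_scope.
Implicit Types F G P Q : R -> R.

Let msnd : measurable_fun [set: R * R] (fun z : R * R => z.2). Proof. exact: measurable_snd. Qed.

Lemma integral_translate (P : R -> R) (y : R) : measurable_fun setT P ->
  (forall x, (0 <= P x)%R) ->
  \int[mu]_x (P (x - y)%R)%:E = \int[mu]_x (P x)%:E.
Proof.
move=> mP P0; rewrite [RHS](@ge0_integral_affine R (- y) 1 (fun x => (P x)%:E) (oner_neq0 R))//; last exact/measurable_EFinP.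
rewrite normr1 mul1e; apply: eq_integral => x _.
by rewrite mul1r addrC.
Qed.

Lemma integral_reflect (P : R -> R) (y : R) : measurable_fun setT P ->
  (forall x, (0 <= P x)%R) ->
  \int[mu]_x (P (y - x)%R)%:E = \int[mu]_x (P x)%:E.
Proof.
move=> mP P0; have N1 : ((-1)%R : R) != 0%R by rewrite oppr_eq0 oner_eq0.
rewrite [RHS](@ge0_integral_affine R y (-1)%R _ N1)//; last exact/measurable_EFinP.
rewrite normrN1 mul1e; apply: eq_integral => x _.
by rewrite mulN1r.
Qed.

(** The substitution u = x + t, v = x - t has Jacobian 2; it is performed as a
    translation in t followed by an affine substitution in x. *)
Lemma integral_shear P Q : measurable_fun setT P -> measurable_fun setT Q ->
  (forall x, (0 <= P x)%R) -> (forall x, (0 <= Q x)%R) ->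
  \int[mu]_x \int[mu]_t (P (x + t) * Q (x - t))%:E =
  (2^-1)%:E * (\int[mu]_x (P x)%:E * \int[mu]_x (Q x)%:E).
Proof.
move=> mP mQ P0 Q0.
have PQ0 a b : 0 <= (P a * Q b)%:E by rewrite lee_fin mulr_ge0.
transitivity (\int[mu]_x \int[mu]_t (P t * Q (2 * x - t))%:E).
  apply: eq_integral => x _.
  rewrite [RHS](@ge0_integral_affine R x 1 _ (oner_neq0 R))//; last first.
    apply/measurable_EFinP; apply: measurable_funM => //.
    by apply: (measurableT_comp mQ); exact: measurable_funB.
  rewrite normr1 mul1e; apply: eq_integral => t _.
  by rewrite mul1r; congr (_ * Q _)%:E; ring.
pose h (z : R * R) := (P z.2 * Q (2 * z.1 - z.2)%R)%:E.
have mh : measurable_fun setT h.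
  apply/measurable_EFinP; apply: measurable_funM; first exact: (measurableT_comp mP msnd).
  apply: (measurableT_comp mQ); apply: measurable_funB => //.
  exact: measurable_funM.
apply: (etrans (fubini_tonelli (m1 := mu) (m2 := mu) h mh (fun z => PQ0 _ _))); rewrite /h /=.
have EQ t : \int[mu]_x (P t * Q (2 * x - t))%:E =
    (P t)%:E * ((2^-1)%:E * \int[mu]_x (Q x)%:E).
  under eq_integral do rewrite EFinM.
  rewrite ge0_integralZl ?lee_fin//; last 2 first.
  - apply/measurable_EFinP; apply: (measurableT_comp mQ).
    by apply: measurable_funB => //; exact: measurable_funM.
  - by move=> x _; rewrite lee_fin.
  congr (_ * _).
  have two0 : (2%R : R) != 0%R by [].
  rewrite [in RHS](@ge0_integral_affine R (- t) 2%R _ two0)//; last exact/measurable_EFinP.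
  rewrite muleA -EFinM ger0_norm// mulVf// mul1e.
  by apply: eq_integral => x _; rewrite addrC.
under eq_integral do rewrite EQ.
rewrite ge0_integralZr//; last 3 first.
- exact/measurable_EFinP.
- by move=> x _; rewrite lee_fin.
- by rewrite mule_ge0 ?lee_fin ?invr_ge0// integral_ge0// => x _; rewrite lee_fin.
by rewrite muleCA.
Qed.

(** Because 1 + (s + t)^2 and 1 + (s - t)^2 are both at most
    2 (1 + s^2) (1 + t^2). *)
Lemma wt_shear (s t : R) :
  (wt t ^+ 2 * wt s ^+ 2 <= 4 * (wt (s + t) * wt (s - t)))%R.
Proof.
have d (z : R) : (0 < 1 + z ^+ 2)%R by rewrite ltr_pwDl// sqr_ge0.
rewrite /wt !exprVn -!invfM ler_pdivlMr ?mulr_gt0// mulrC ler_pdivrMr; last first.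
  by rewrite mulr_gt0// exprn_gt0.
have h1 : (1 + (s + t) ^+ 2 <= 2 * ((1 + s ^+ 2) * (1 + t ^+ 2)))%R.
  by have := sqr_ge0 (s - t); have := sqr_ge0 (s * t); rewrite exprMn; nra.
have h2 : (1 + (s - t) ^+ 2 <= 2 * ((1 + s ^+ 2) * (1 + t ^+ 2)))%R.
  by have := sqr_ge0 (s + t); have := sqr_ge0 (s * t); rewrite exprMn; nra.
have := ler_pM (ltW (d _)) (ltW (d _)) h1 h2.
by move=> h; apply: (le_trans h); rewrite le_eqVlt; apply/orP; left; apply/eqP; ring.
Qed.

Definition wt_avg F (y : R) : R := (\int[mu]_u (F u * wt (u - y)))%R.

Section average.
Variables (F : R -> R) (M : R).
Hypotheses (mF : measurable_fun setT F) (F0 : forall x, (0 <= F x)%R).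
Hypothesis FM : forall x, (F x <= M)%R.

Let mwt y : measurable_fun setT (fun u : R => wt (u - y)).
Proof. by apply: (measurableT_comp (@measurable_wt R)); exact: measurable_funB. Qed.

Lemma wt_avgE y : (wt_avg F y)%:E = \int[mu]_u (F u * wt (u - y))%:E.
Proof.
rewrite /wt_avg -rintegrableE//.
apply: (@rintegrable_le _ _ (fun u => M * wt (u - y))%R).
- exact: measurable_funM.
- apply/rintegrableZl.
  have := @integrable_affine R (- y) 1 (@wt R) (oner_neq0 R) (rintegrable_wt R).
  by congr (integrable _ _ _); apply/funext => x /=; rewrite mul1r addrC.
- by move=> u; rewrite ger0_norm ?mulr_ge0 ?wt_ge0// ler_wpM2r ?wt_ge0.
Qed.

Lemma wt_avg_ge0 y : (0 <= wt_avg F y)%R.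
Proof. by apply: Rintegral_ge0 => u _; rewrite mulr_ge0 ?wt_ge0. Qed.

Lemma measurable_wt_avg : measurable_fun setT (wt_avg F).
Proof.
pose h (z : R * R) := (F z.2 * wt (z.2 - z.1)%R)%:E.
have mh : measurable_fun setT h.
  apply/measurable_EFinP; apply: measurable_funM; first exact: (measurableT_comp mF msnd).
  by apply: (measurableT_comp (@measurable_wt R)); exact: measurable_funB.
have h0 z : 0 <= h z by rewrite lee_fin mulr_ge0 ?wt_ge0.
apply/measurable_EFinP.
have := measurable_fun_fubini_tonelli_F (m2 := mu) h mh h0.
by congr measurable_fun; apply/funext => y; rewrite /= wt_avgE.
Qed.

(** Jensen's inequality with the exponent 1/r, applied pointwise to F^r; then the
    integral of the weight in y is pi. *)
Lemma wt_avg_powR (r : R) : (1 <= r)%R ->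
  \int[mu]_y (wt_avg F y `^ r)%:E <=
  ((1 + pi) `^ r * pi)%:E * \int[mu]_x (F x `^ r)%:E.
Proof.
move=> r1; have r0 : (0 < r)%R by exact: lt_le_trans r1.
have pi1 : (0 <= 1 + pi :> R)%R by rewrite addr_ge0// pi_ge0.
have mFr : measurable_fun setT (fun x => F x `^ r)%R.
  exact: (measurableT_comp (measurable_powR r) mF).
have pt y : (wt_avg F y `^ r)%:E <=
    ((1 + pi) `^ r)%:E * \int[mu]_u (F u `^ r * wt (u - y))%:E.
  have J := @weighted_jensen R (fun u => (F u `^ r)%:E) (fun u => wt (u - y)) r^-1 pi.
  have : (wt_avg F y)%:E <= (1 + pi)%:E * (\int[mu]_u (F u `^ r * wt (u - y))%:E) `^ r^-1.
    rewrite wt_avgE; apply: le_trans (J _ _ _ _ _ _ _).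
    - rewrite le_eqVlt; apply/orP; left; apply/eqP; apply: eq_integral => u _.
      by rewrite poweR_EFin -powRrM mulfV ?gt_eqF// powRr1.
    - by rewrite invr_gt0.
    - by rewrite invf_le1.
    - exact/measurable_EFinP.
    - by move=> u; rewrite lee_fin powR_ge0.
    - exact: mwt.
    - by move=> u; exact: wt_ge0.
    - by rewrite integral_translate ?integral_wt//; [exact: measurable_wt|exact: wt_ge0].
  set I := \int[mu]_u _ => H.
  have I0 : 0 <= I by apply: integral_ge0 => u _; rewrite lee_fin mulr_ge0 ?powR_ge0 ?wt_ge0.
  rewrite -poweR_EFin.
  apply: (@le_trans _ _ (((1 + pi)%:E * I `^ r^-1) `^ r)).
    rewrite gt0_ler_poweR ?(ltW r0)//= ?in_itv/= ?andbT ?leey ?lee_fin ?wt_avg_ge0//.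
    by rewrite mule_ge0 ?poweR_ge0// lee_fin addr_ge0 ?pi_ge0.
  rewrite poweRM ?poweR_ge0 ?lee_fin//.
  by rewrite -poweRrM mulVf ?gt_eqF// poweRe1.
apply: (@le_trans _ _ (\int[mu]_y (((1 + pi) `^ r)%:E * \int[mu]_u (F u `^ r * wt (u - y))%:E))).
  by apply: ge0_le_integralT => y //; rewrite lee_fin powR_ge0.
have mFw : measurable_fun setT (fun z : R * R => (F z.2 `^ r * wt (z.2 - z.1))%:E).
  apply/measurable_EFinP; apply: measurable_funM; first exact: (measurableT_comp mFr msnd).
  by apply: (measurableT_comp (@measurable_wt R)); exact: measurable_funB.
have Fw0 (z : R * R) : 0 <= (F z.2 `^ r * wt (z.2 - z.1))%:E.
  by rewrite lee_fin mulr_ge0 ?powR_ge0 ?wt_ge0.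
rewrite ge0_integralZl ?lee_fin ?powR_ge0//; last 2 first.
- exact: (measurable_fun_fubini_tonelli_F (m2 := mu) _ mFw Fw0).
- by move=> y _; apply: integral_ge0 => u _; exact: (Fw0 (y, u)).
rewrite [X in _ * X](fubini_tonelli (m1 := mu) (m2 := mu) _ mFw Fw0) /=.
have E u : \int[mu]_y (F u `^ r * wt (u - y))%:E = (F u `^ r)%:E * pi%:E.
  under eq_integral do rewrite EFinM.
  rewrite ge0_integralZl ?lee_fin ?powR_ge0//; last 2 first.
  - apply/measurable_EFinP; apply: (measurableT_comp (@measurable_wt R)).
    exact: measurable_funB.
  - by move=> y _; rewrite lee_fin wt_ge0.
  rewrite integral_reflect ?integral_wt//; [exact: measurable_wt|exact: wt_ge0].
under eq_integral do rewrite E.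
rewrite ge0_integralZr ?lee_fin ?pi_ge0//; last 2 first.
- exact/measurable_EFinP.
- by move=> u _; rewrite lee_fin powR_ge0.
by rewrite EFinM -muleA [pi%:E * _]muleC.
Qed.

End average.

(** Hoelder's inequality for a^q and b^q with the conjugate exponents r1/q and
    r2/q. *)
Lemma hoelder_powR (a b : R -> R) (q r1 r2 : R) :
  (0 < q)%R -> (0 < r1)%R -> (0 < r2)%R -> (q / r1 + q / r2 = 1)%R ->
  measurable_fun setT a -> measurable_fun setT b ->
  (forall x, (0 <= a x)%R) -> (forall x, (0 <= b x)%R) ->
  \int[mu]_x (a x `^ q * b x `^ q)%:E <=
  (\int[mu]_x (a x `^ r1)%:E) `^ (q / r1) * (\int[mu]_x (b x `^ r2)%:E) `^ (q / r2).
Proof.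
move=> q0 r10 r20 qr ma mb a0 b0.
have maq : measurable_fun setT (fun x => a x `^ q)%R.
  exact: (measurableT_comp (measurable_powR q) ma).
have mbq : measurable_fun setT (fun x => b x `^ q)%R.
  exact: (measurableT_comp (measurable_powR q) mb).
have := @hoelder _ _ _ mu _ _ (r1 / q) (r2 / q) maq mbq.
rewrite !divr_gt0// !invf_div => /(_ isT isT qr).
have LE (c : R -> R) (r : R) : (forall x, (0 <= c x)%R) -> (0 < r)%R ->
    'N[mu]_(r / q)%:E[EFin \o (fun x => c x `^ q)%R] =
    (\int[mu]_x (c x `^ r)%:E) `^ (q / r).
  move=> c0 r0; rewrite unlock /= invf_div; congr (_ `^ _).
  apply: eq_integral => x _; rewrite ger0_norm ?powR_ge0//.
  by rewrite -powRrM mulrCA mulfV ?gt_eqF// mulr1.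
rewrite Lnorm1 !LE//; apply: le_trans.
apply: ge0_le_integralT => x; first by rewrite lee_fin mulr_ge0 ?powR_ge0.
by rewrite /= lee_fin ler_norm.
Qed.

End bilinear_average.

Section bilinear_average_bound.
Context (R : realType).
Local Notation mu := (@lebesgue_measure R).
Local Open Scope ereal_scope.

Lemma Rintegral_wt2_gt0 : (0 < \int[mu]_x (wt x ^+ 2))%R.
Proof.
have m2 : measurable_fun setT (fun x : R => wt x ^+ 2)%R.
  by apply: measurable_funX; exact: measurable_wt.
have i2 : rintegrable (fun x : R => wt x ^+ 2)%R.
  apply: (rintegrable_le m2 (rintegrable_wt R)) => x.
  by rewrite ger0_norm ?exprn_ge0 ?wt_ge0// expr2 ler_piMr ?wt_ge0 ?wt_le1.
rewrite -lte_fin -rintegrableE//.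
apply: (@lt_le_trans _ _ (\int[mu]_(x in `[0%R, 1%R]) (4^-1)%:E)).
  rewrite integral_cst//= lebesgue_measure_itv/= lte_fin ltr01 -EFinB subr0 mule1.
  by rewrite lte_fin invr_gt0.
rewrite integral_mkcond; apply: ge0_le_integralT => x; rewrite patchE.
  by case: ifP => //; rewrite lee_fin invr_ge0.
case: ifPn => [|_]; last by rewrite lee_fin sqr_ge0.
rewrite inE /= in_itv/= => /andP[x0 x1]; rewrite lee_fin /wt exprVn lef_pV2 ?posrE//.
  by have : (x ^+ 2 <= 1)%R; [rewrite expr_le1|have := sqr_ge0 x; nra].
by rewrite exprn_gt0// ltr_pwDl// sqr_ge0.
Qed.

Definition pair_avg (F G : R -> R) (x : R) : \bar R :=
  \int[mu]_t (wt t ^+ 2 * (F (x + t) * G (x - t)))%:E.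

Section pair.
Variables (F G : R -> R).
Hypotheses (mF : measurable_fun setT F) (mG : measurable_fun setT G).
Hypotheses (F0 : forall x, (0 <= F x)%R) (G0 : forall x, (0 <= G x)%R).

Let h (z : R * R) : \bar R := (wt z.2 ^+ 2 * (F (z.1 + z.2) * G (z.1 - z.2)))%:E.

Let mh : measurable_fun setT h.
Proof.
have m1 : measurable_fun [set: R * R] (fun z : R * R => z.1) by exact: measurable_fst.
have m2 : measurable_fun [set: R * R] (fun z : R * R => z.2) by exact: measurable_snd.
apply/measurable_EFinP; apply: measurable_funM.
  by apply: measurable_funX; exact: (measurableT_comp (@measurable_wt R) m2).
apply: measurable_funM.
  by apply: (measurableT_comp mF); exact: measurable_funD.
by apply: (measurableT_comp mG); exact: measurable_funB.
Qed.

Let h0 z : 0 <= h z.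
Proof. by rewrite lee_fin !mulr_ge0 ?wt_ge0. Qed.

Lemma pair_avg_ge0 x : 0 <= pair_avg F G x.
Proof. by apply: integral_ge0 => t _; exact: (h0 (x, t)). Qed.

Lemma measurable_pair_avg : measurable_fun setT (pair_avg F G).
Proof. exact: (measurable_fun_fubini_tonelli_F (m2 := mu) h mh h0). Qed.

Variable M : R.
Hypotheses (FM : forall x, (F x <= M)%R) (GM : forall x, (G x <= M)%R).

(** Against a weight centred at y, [wt_shear] splits the double integral into a
    product of two independent averages. *)
Lemma pair_avg_localized y :
  \int[mu]_x (pair_avg F G x * (wt (x - y) ^+ 2)%:E) <=
  (2 * (wt_avg F y * wt_avg G y))%:E.
Proof.
pose P u := (F u * wt (u - y))%R; pose Q u := (G u * wt (u - y))%R.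
have mw : measurable_fun setT (fun u : R => wt (u - y)).
  by apply: (measurableT_comp (@measurable_wt R)); exact: measurable_funB.
have P0 u : (0 <= P u)%R by rewrite mulr_ge0 ?wt_ge0.
have Q0 u : (0 <= Q u)%R by rewrite mulr_ge0 ?wt_ge0.
have mP : measurable_fun setT P by exact: measurable_funM.
have mQ : measurable_fun setT Q by exact: measurable_funM.
apply: (@le_trans _ _ (\int[mu]_x (4%:E * \int[mu]_t (P (x + t) * Q (x - t))%:E))).
  apply: ge0_le_integralT => x.
    by rewrite mule_ge0 ?pair_avg_ge0// lee_fin sqr_ge0.
  have mx1 : measurable_fun setT (fun t : R => x + t)%R by exact: measurable_funD.
  have mx2 : measurable_fun setT (fun t : R => x - t)%R by exact: measurable_funB.
  rewrite -ge0_integralZr//; last 3 first.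
  - exact: (measurableT_comp mh (pair1_measurable x)).
  - by move=> t _; exact: (h0 (x, t)).
  - by rewrite lee_fin sqr_ge0.
  rewrite -ge0_integralZl//; last 2 first.
  - apply/measurable_EFinP; apply: measurable_funM.
      exact: (measurableT_comp mP mx1).
    exact: (measurableT_comp mQ mx2).
  - by move=> t _; rewrite lee_fin mulr_ge0.
  apply: ge0_le_integralT => t.
    by rewrite mule_ge0 ?lee_fin ?sqr_ge0//; exact: (h0 (x, t)).
  rewrite -!EFinM lee_fin /P /Q.
  have := wt_shear (x - y) t.
  rewrite (_ : x - y + t = x + t - y)%R; last by ring.
  rewrite (_ : x - y - t = x - t - y)%R; last by ring.
  move=> /(ler_wpM2l (mulr_ge0 (F0 (x + t)) (G0 (x - t)))).
  by congr (_ <= _)%R; ring.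
rewrite ge0_integralZl//; last 2 first.
- apply: (measurable_fun_fubini_tonelli_F (m2 := mu) (fun z : R * R => (P (z.1 + z.2) * Q (z.1 - z.2))%:E)) => [|z]; last by rewrite lee_fin mulr_ge0.
  have m1 : measurable_fun [set: R * R] (fun z : R * R => z.1) by exact: measurable_fst.
  have m2 : measurable_fun [set: R * R] (fun z : R * R => z.2) by exact: measurable_snd.
  apply/measurable_EFinP; apply: measurable_funM.
    by apply: (measurableT_comp mP); exact: measurable_funD.
  by apply: (measurableT_comp mQ); exact: measurable_funB.
- by move=> x _; apply: integral_ge0 => t _; rewrite lee_fin mulr_ge0.
rewrite integral_shear// -(wt_avgE mF F0 FM) -(wt_avgE mG G0 GM) -!EFinM lee_fin.
by move: (wt_avg F y * wt_avg G y)%R => c; lra.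
Qed.

(** Spread A(x)^q over y with the weight wt(x - y)^2, exchange the integrals, and
    apply Jensen's inequality in x for each y. *)
Lemma pair_avg_powR_localize (q : R) : (0 < q)%R -> (q <= 1)%R ->
  \int[mu]_x (pair_avg F G x `^ q) * (\int[mu]_x (wt x ^+ 2))%:E <=
  ((1 + pi) * 2 `^ q)%:E * \int[mu]_y (wt_avg F y `^ q * wt_avg G y `^ q)%:E.
Proof.
move=> q0 q1; pose A := pair_avg F G.
have m2 : measurable_fun setT (fun x : R => wt x ^+ 2)%R.
  by apply: measurable_funX; exact: measurable_wt.
have w20 (x : R) : (0 <= wt x ^+ 2)%R by exact: sqr_ge0.
have i2 : rintegrable (fun x : R => wt x ^+ 2)%R.
  apply: (rintegrable_le m2 (rintegrable_wt R)) => x.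
  by rewrite ger0_norm// expr2 ler_piMr ?wt_ge0 ?wt_le1.
have mAq : measurable_fun setT (fun x => A x `^ q).
  exact: (measurableT_comp (measurable_poweR q) measurable_pair_avg).
have Aq0 x : 0 <= A x `^ q by exact: poweR_ge0.
pose k (z : R * R) : \bar R := A z.1 `^ q * (wt (z.1 - z.2) ^+ 2)%:E.
have mk : measurable_fun setT k.
  have m1 : measurable_fun [set: R * R] (fun z : R * R => z.1) by exact: measurable_fst.
  have m2' : measurable_fun [set: R * R] (fun z : R * R => z.2) by exact: measurable_snd.
  apply: emeasurable_funM; first exact: (measurableT_comp mAq m1).
  apply/measurable_EFinP; apply: (measurableT_comp m2).
  exact: measurable_funB.
have k0 z : 0 <= k z by rewrite mule_ge0 ?lee_fin.
have -> : \int[mu]_x (A x `^ q) * (\int[mu]_x (wt x ^+ 2))%:E =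
    \int[mu]_x \int[mu]_y k (x, y).
  rewrite -ge0_integralZr//; last first.
    by rewrite lee_fin; apply: Rintegral_ge0.
  apply: eq_integral => x _.
  have mx : measurable_fun setT (fun y : R => (wt (x - y) ^+ 2)%:E).
    apply/measurable_EFinP; apply: (measurableT_comp m2).
    exact: measurable_funB.
  rewrite /k /= ge0_integralZl//; last by move=> y _; rewrite lee_fin.
  by rewrite (integral_reflect x m2 w20) rintegrableE.
rewrite (fubini_tonelli (m1 := mu) (m2 := mu) k mk k0).
have mab : measurable_fun setT (fun y => (wt_avg F y `^ q * wt_avg G y `^ q)%:E).
  apply/measurable_EFinP; apply: measurable_funM.
    exact: (measurableT_comp (measurable_powR q) (measurable_wt_avg mF F0 FM)).
  exact: (measurableT_comp (measurable_powR q) (measurable_wt_avg mG G0 GM)).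
have pi1 : (0 <= 1 + pi :> R)%R by rewrite addr_ge0// pi_ge0.
rewrite -ge0_integralZl//; last 2 first.
- by move=> y _; rewrite lee_fin mulr_ge0 ?powR_ge0.
- by rewrite lee_fin mulr_ge0 ?powR_ge0.
apply: ge0_le_integralT => y; first by apply: integral_ge0 => x _; exact: k0.
apply: (@le_trans _ _ ((1 + pi)%:E *
    (\int[mu]_x (A x * (wt (x - y) ^+ 2)%:E)) `^ q)).
  apply: weighted_jensen => //.
  - exact: measurable_pair_avg.
  - exact: pair_avg_ge0.
  - have my : measurable_fun setT (fun x : R => x - y)%R by exact: measurable_funB.
    exact: (measurableT_comp m2 my).
  - rewrite (integral_translate y m2 w20) -integral_wt.
    apply: ge0_le_integralT => x; first by rewrite lee_fin.
    by rewrite lee_fin expr2 ler_piMr ?wt_ge0 ?wt_le1.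
rewrite [((1 + pi) * _)%:E]EFinM -muleA lee_wpmul2l ?lee_fin//.
apply: (@le_trans _ _ ((2 * (wt_avg F y * wt_avg G y))%:E `^ q)).
  rewrite gt0_ler_poweR ?(ltW q0) ?in_itv/= ?leey ?andbT//.
  - by apply: integral_ge0 => x _; rewrite mule_ge0 ?pair_avg_ge0 ?lee_fin.
  - by rewrite lee_fin !mulr_ge0// wt_avg_ge0.
  - exact: pair_avg_localized.
by rewrite poweR_EFin !powRM ?mulr_ge0 ?wt_avg_ge0// EFinM.
Qed.

End pair.

Lemma pair_avg_bound (q r1 r2 : R) : (0 < q)%R -> (q <= 1)%R ->
  (1 <= r1)%R -> (1 <= r2)%R -> (q / r1 + q / r2 = 1)%R ->
  exists C : R, (0 <= C)%R /\ forall (F G : R -> R) (M : R),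
    measurable_fun setT F -> measurable_fun setT G ->
    (forall x, 0 <= F x <= M)%R -> (forall x, 0 <= G x <= M)%R ->
    \int[mu]_x (pair_avg F G x `^ q) <=
    C%:E * ((\int[mu]_x (F x `^ r1)%:E) `^ (q / r1) *
            (\int[mu]_x (G x `^ r2)%:E) `^ (q / r2)).
Proof.
move=> q0 q1 r11 r21 qr.
have r10 : (0 < r1)%R by exact: lt_le_trans r11.
have r20 : (0 < r2)%R by exact: lt_le_trans r21.
pose W2 : R := (\int[mu]_x (wt x ^+ 2))%R.
have W20 : (0 < W2)%R by exact: Rintegral_wt2_gt0.
have pi1 : (0 <= 1 + pi :> R)%R by rewrite addr_ge0// pi_ge0.
pose c1 : R := ((1 + pi) * 2 `^ q)%R.
pose k (r : R) : R := ((1 + pi) `^ r * pi)%R.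
have k0 r : (0 <= k r)%R by rewrite mulr_ge0 ?powR_ge0 ?pi_ge0.
have c10 : (0 <= c1)%R by rewrite mulr_ge0 ?powR_ge0.
pose C : R := (W2^-1 * (c1 * (k r1 `^ (q / r1) * k r2 `^ (q / r2))))%R.
exists C; split; first by rewrite !mulr_ge0 ?invr_ge0 ?powR_ge0 ?(ltW W20).
move=> F G M mF mG HF HG.
have F0 x : (0 <= F x)%R by have /andP[] := HF x.
have FM x : (F x <= M)%R by have /andP[] := HF x.
have G0 x : (0 <= G x)%R by have /andP[] := HG x.
have GM x : (G x <= M)%R by have /andP[] := HG x.
have IF0 : 0 <= \int[mu]_x (F x `^ r1)%:E by apply: integral_ge0 => x _; rewrite lee_fin powR_ge0.
have IG0 : 0 <= \int[mu]_x (G x `^ r2)%:E by apply: integral_ge0 => x _; rewrite lee_fin powR_ge0.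
have H1 := pair_avg_powR_localize mF mG F0 G0 FM GM q0 q1.
have H2 := hoelder_powR q0 r10 r20 qr (measurable_wt_avg mF F0 FM)
  (measurable_wt_avg mG G0 GM) (wt_avg_ge0 F0) (wt_avg_ge0 G0).
have H3 : (\int[mu]_y (wt_avg F y `^ r1)%:E) `^ (q / r1) <=
    ((k r1)%:E * \int[mu]_x (F x `^ r1)%:E) `^ (q / r1).
  rewrite gt0_ler_poweR ?divr_ge0 ?(ltW q0) ?(ltW r10) ?in_itv/= ?leey ?andbT//.
  - by apply: integral_ge0 => x _; rewrite lee_fin powR_ge0.
  - by rewrite mule_ge0 ?lee_fin.
  - exact: wt_avg_powR.
have H4 : (\int[mu]_y (wt_avg G y `^ r2)%:E) `^ (q / r2) <=
    ((k r2)%:E * \int[mu]_x (G x `^ r2)%:E) `^ (q / r2).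
  rewrite gt0_ler_poweR ?divr_ge0 ?(ltW q0) ?(ltW r20) ?in_itv/= ?leey ?andbT//.
  - by apply: integral_ge0 => x _; rewrite lee_fin powR_ge0.
  - by rewrite mule_ge0 ?lee_fin.
  - exact: wt_avg_powR.
have H5 := le_trans H2 (lee_pmul (poweR_ge0 _ _) (poweR_ge0 _ _) H3 H4).
have H6 := le_trans H1 (lee_wpmul2l (_ : 0 <= c1%:E) H5).
have {}H6 := H6 c10.
have -> : \int[mu]_x (pair_avg F G x `^ q) =
    (W2^-1)%:E * (\int[mu]_x (pair_avg F G x `^ q) * W2%:E).
  by rewrite muleC -muleA -EFinM mulfV ?mule1// gt_eqF.
rewrite /C EFinM -muleA lee_wpmul2l ?lee_fin ?invr_ge0 ?(ltW W20)//.
apply: (le_trans H6); rewrite [(c1 * _)%:E]EFinM -muleA lee_wpmul2l ?lee_fin//.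
rewrite !poweRM ?lee_fin// !poweR_EFin [(_ * k r2 `^ _)%:E]EFinM.
by rewrite muleACA.
Qed.

End bilinear_average_bound.

(** * The square function estimate *)

Section square_function_bound.
Context (R : realType).
Local Notation mu := (@lebesgue_measure R).
Local Notation normc := (@Normc.normc R).

Definition sqnorm (f : R -> R[i]) (x : R) : R := normc (f x) ^+ 2.

(** Amounts to |kappa(t)|^2 (1 + t^2)^3 <= K, which follows from the decay of
    kappa of orders 0 and 3 since (1 + t^2)^3 <= 4 (1 + t^6). *)
Lemma schwartz_fourier_wt (phi : R -> R[i]) : schwartz phi ->
  exists K : R, 0 <= K /\
    forall t, normc (fourier phi t) ^+ 2 / wt t <= K * wt t ^+ 2.
Proof.
move=> sphi; have [M0 H0] := fourier_decay 0 sphi; have [M3 H3] := fourier_decay 3 sphi.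
exists (4 * (M0 ^+ 2 + M3 ^+ 2)); split; first by rewrite mulr_ge0// addr_ge0// sqr_ge0.
move=> t; rewrite /wt exprVn invrK ler_pdivlMr; last first.
  by rewrite exprn_gt0// ltr_pwDl// sqr_ge0.
have {H0} := H0 t; have {H3} := H3 t; rewrite expr0 mul1r.
move: (normc _) (normc_ge0 (fourier phi t)) => k k0 H3 H0.
have h0 : k ^+ 2 <= M0 ^+ 2 by rewrite lerXn2r ?nnegrE// (le_trans k0).
have h3 : t ^+ 6 * k ^+ 2 <= M3 ^+ 2.
  have -> : t ^+ 6 * k ^+ 2 = (`|t| ^+ 3 * k) ^+ 2.
    by rewrite exprMn -exprM -[3%N]/(3%N) (_ : (3 * 2 = 2 * 3)%N)// exprM real_normK ?num_real// -exprM.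
  by rewrite lerXn2r ?nnegrE ?mulr_ge0 ?exprn_ge0// (le_trans _ H3)// mulr_ge0 ?exprn_ge0.
have cubic : (1 + t ^+ 2) ^+ 3 <= 4 * (1 + t ^+ 6).
  have -> : t ^+ 6 = (t ^+ 2) ^+ 3 by rewrite -exprM.
  have := sqr_ge0 t; move: (t ^+ 2) => s s0.
  rewrite -subr_ge0 (_ : _ - _ = 3 * ((1 - s) ^+ 2 * (1 + s))); last by ring.
  by rewrite mulr_ge0// mulr_ge0 ?sqr_ge0// addr_ge0.
have -> : k ^+ 2 * (1 + t ^+ 2) * (1 + t ^+ 2) ^+ 2 = k ^+ 2 * (1 + t ^+ 2) ^+ 3 by ring.
apply: (le_trans (ler_wpM2l (sqr_ge0 k) cubic)).
rewrite mulrCA ler_wpM2l// mulrDr mulr1 lerD// mulrC//.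
Qed.

Lemma measurable_sqnorm (f : R -> R[i]) : schwartz f -> measurable_fun setT (sqnorm f).
Proof.
by move=> sf; apply: measurable_funX; apply: cmeasurable_normc; exact/cintegrable_meas/schwartz_cintegrable.
Qed.

(** The unordered sum is a supremum over finite sets of integers, to each of which
    the weighted Bessel inequality applies with the same constant. *)
Lemma esum_multiplier_le (phi : R -> R[i]) : schwartz phi ->
  exists K : R, 0 <= K /\ forall (f g : R -> R[i]) (x : R),
    schwartz f -> schwartz g ->
    (\esum_(n in [set: int]) (normc (bilinear_multiplier
        (fun xi => phi (xi - n%:~R)%R) f g x) ^+ 2)%:E <=
     K%:E * pair_avg (sqnorm f) (sqnorm g) x)%E.
Proof.
move=> sphi; have [K [K0 HK]] := schwartz_fourier_wt sphi.
exists (4 * pi * K); split; first by rewrite !mulr_ge0 ?pi_ge0.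
move=> f g x sf sg.
have [Mf fM] := schwartz_bounded sf; have [Mg gM] := schwartz_bounded sg.
have ck := schwartz_fourier_cintegrable sphi.
pose h t := fourier phi t * f (x + t) * g (x - t).
have mft : cmeasurable (fun t : R => f (x + t)).
  by apply: (cmeasurable_comp (cintegrable_meas (schwartz_cintegrable sf))); exact: measurable_funD.
have mgt : cmeasurable (fun t : R => g (x - t)).
  by apply: (cmeasurable_comp (cintegrable_meas (schwartz_cintegrable sg))); exact: measurable_funB.
have ch : cintegrable h.
  have c1 : cintegrable (fun t => fourier phi t * f (x + t)).
    exact: (cintegrable_mul_bounded ck mft (fun t => fM _)).
  exact: (cintegrable_mul_bounded c1 mgt (fun t => gM _)).
pose H t := wt t ^+ 2 * (sqnorm f (x + t) * sqnorm g (x - t)).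
have H0 t : 0 <= H t.
  exact: (mulr_ge0 (sqr_ge0 _) (mulr_ge0 (sqr_ge0 _) (sqr_ge0 _))).
have mw2 : measurable_fun setT (fun t : R => wt t ^+ 2).
  by apply: measurable_funX; exact: measurable_wt.
have mH : measurable_fun setT H.
  apply: measurable_funM => //.
  by apply: measurable_funM; apply: measurable_funX; exact: cmeasurable_normc.
have iH : rintegrable H.
  apply: (rintegrable_le mH (rintegrableZl (Mf ^+ 2 * Mg ^+ 2) (rintegrable_wt R))) => t.
  rewrite ger0_norm// /H mulrC; apply: ler_pM.
  - exact: (mulr_ge0 (sqr_ge0 _) (sqr_ge0 _)).
  - exact: sqr_ge0.
  - apply: ler_pM; [exact: sqr_ge0|exact: sqr_ge0| |].
      rewrite lerXn2r ?nnegrE ?normc_ge0//.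
      exact: le_trans (normc_ge0 _) (fM 0).
    rewrite lerXn2r ?nnegrE ?normc_ge0//.
    exact: le_trans (normc_ge0 _) (gM 0).
  - by rewrite expr2 ler_piMr ?wt_ge0 ?wt_le1.
have hH t : normc (h t) ^+ 2 / wt t <= K * H t.
  rewrite /h !normcM !exprMn /H mulrA -/(sqnorm f (x + t)) -/(sqnorm g (x - t)).
  rewrite -[leLHS]mulrA mulrAC -mulrA [X in _ * X]mulrC.
  have := ler_wpM2r (mulr_ge0 (sqr_ge0 (normc (f (x + t)))) (sqr_ge0 (normc (g (x - t))))) (HK t).
  by rewrite /sqnorm; congr (_ <= _); ring.
have mh2 : measurable_fun setT (fun t => normc (h t) ^+ 2 / wt t).
  apply: measurable_funM.
    by apply: measurable_funX; apply: cmeasurable_normc; exact: cintegrable_meas.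
  rewrite /wt; under eq_fun do rewrite invrK.
  by apply: measurable_funD => //; exact: measurable_funX.
have ih2 : rintegrable (fun t => normc (h t) ^+ 2 / wt t).
  apply: (rintegrable_le mh2 (rintegrableZl K iH)) => t.
  by rewrite ger0_norm// divr_ge0 ?sqr_ge0 ?wt_ge0.
rewrite /esum; apply: ge_ereal_sup => _ [A [finA _] <-].
rewrite fsbig_finite// sumEFin.
rewrite (eq_bigr (fun n : int => normc (fourier h n%:~R) ^+ 2)); last first.
  by move=> n _; congr (normc _ ^+ 2); exact: bilinear_multiplierE.
rewrite /pair_avg -/H (rintegrableE iH) -EFinM lee_fin.
apply: (le_trans (weighted_bessel (finmap.fset_uniq _) ch ih2)).
rewrite -[leRHS]mulrA ler_wpM2l ?mulr_ge0 ?pi_ge0//.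
rewrite -RintegralZl//; apply: le_Rintegral => //; exact: rintegrableZl.
Qed.

(** If p1 were infinite, then p2 = p3, against p3 <= 2 < p2. *)
Lemma inve_conjugate_finite (p1 p2 p3 : \bar R) : (2%:E < p2)%E -> (p3 <= 2%:E)%E ->
  (p1^-1 + p2^-1 = p3^-1)%E -> p1 != +oo%E.
Proof.
move=> hp2 hp3 hp; apply/eqP => p1y; move: hp; rewrite p1y invey add0e => /(can_inj (@inveK R)) E.
by move: hp2; rewrite E ltNge hp3.
Qed.

Lemma cLnormE (f : R -> R[i]) (a : R) : 0 < a ->
  cLnorm a%:E f = ((\int[mu]_x (sqnorm f x `^ (a / 2))%:E) `^ a^-1)%E.
Proof.
move=> a0; rewrite /cLnorm unlock; congr (_ `^ _)%E; apply: eq_integral => x _.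
rewrite /= ger0_norm ?normc_ge0//; congr _%:E.
by rewrite /sqnorm -powR_mulrn ?normc_ge0// -powRrM mulrC divfK.
Qed.

End square_function_bound.

Theorem mainTheorem3 (R : realType) (phi : R -> R[i]) (hphi : schwartz phi)
    (p1 p2 p3 : \bar R)
    (hp1 : (2%:E < p1)%E) (hp2 : (2%:E < p2)%E)
    (hp3 : (1%:E < p3)%E) (hp3' : (p3 <= 2%:E)%E)
    (hp : (p1^-1 + p2^-1 = p3^-1)%E) :
  exists C : R, 0 < C /\
    forall f g : R -> R[i], schwartz f -> schwartz g ->
      (Lnorm (@lebesgue_measure R) p3
         (square_function (fun n : int =>
            bilinear_multiplier (fun xi => phi (xi - n%:~R)%R) f g))
       <= C%:E * cLnorm p1 f * cLnorm p2 g)%E.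
Proof.
have p1fin := inve_conjugate_finite hp2 hp3' hp.
have p2fin : p2 != +oo%E.
  by apply: (inve_conjugate_finite hp1 hp3'); rewrite addeC.
case: p1 hp1 hp p1fin => [a| |] //; case: p2 hp2 p2fin => [b| |] //.
case: p3 hp3 hp3' => [c| |] //; rewrite !lte_fin lee_fin => c1 c2 b2 _ a2.
have a0 : 0 < a by apply: lt_trans a2.
have b0 : 0 < b by apply: lt_trans b2.
have c0 : 0 < c by apply: lt_trans c1.
have inv (r : R) : 0 < r -> (r%:E^-1 = (r^-1)%:E)%E.
  by move=> r0; rewrite inver gt_eqF.
rewrite !inv// -EFinD => -[abc] _.
pose q := c / 2; pose r1 := a / 2; pose r2 := b / 2.
have q0 : 0 < q by rewrite divr_gt0.
have qr1 : q / r1 = c / a by rewrite /q /r1; field; rewrite gt_eqF.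
have qr2 : q / r2 = c / b by rewrite /q /r2; field; rewrite gt_eqF.
have [K [K0 HK]] := esum_multiplier_le hphi.
have q1 : q <= 1 by rewrite ler_pdivrMr// mul1r.
have r11 : 1 <= r1 by rewrite ler_pdivlMr// mul1r ltW.
have r21 : 1 <= r2 by rewrite ler_pdivlMr// mul1r ltW.
have qr : q / r1 + q / r2 = 1.
  by rewrite qr1 qr2 -mulrDr abc mulfV// gt_eqF.
have [C0 [C00 HC]] := pair_avg_bound q0 q1 r11 r21 qr.
pose B : R := (K `^ q * C0) `^ c^-1.
exists (B + 1); split; first by rewrite ltr_wpDl ?powR_ge0.
move=> f g sf sg.
have [Mf fM] := schwartz_bounded sf; have [Mg gM] := schwartz_bounded sg.
pose M := Mf ^+ 2 + Mg ^+ 2.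
have Mf0 : 0 <= Mf by exact: le_trans (normc_ge0 _) (fM 0).
have Mg0 : 0 <= Mg by exact: le_trans (normc_ge0 _) (gM 0).
have FM x : 0 <= sqnorm f x <= M.
  rewrite sqr_ge0 (@le_trans _ _ (Mf ^+ 2))//; last by rewrite lerDl sqr_ge0.
  by rewrite lerXn2r ?nnegrE ?normc_ge0.
have GM x : 0 <= sqnorm g x <= M.
  rewrite sqr_ge0 (@le_trans _ _ (Mg ^+ 2))//; last by rewrite lerDr sqr_ge0.
  by rewrite lerXn2r ?nnegrE ?normc_ge0.
have mF := measurable_sqnorm sf; have mG := measurable_sqnorm sg.
have F0 x : 0 <= sqnorm f x by exact: sqr_ge0.
have G0 x : 0 <= sqnorm g x by exact: sqr_ge0.
set S := square_function _.
set IF := (\int[lebesgue_measure]_x (sqnorm f x `^ r1)%:E)%E.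
set IG := (\int[lebesgue_measure]_x (sqnorm g x `^ r2)%:E)%E.
have IF0 : (0 <= IF)%E by apply: integral_ge0 => x _; rewrite lee_fin powR_ge0.
have IG0 : (0 <= IG)%E by apply: integral_ge0 => x _; rewrite lee_fin powR_ge0.
have mA := measurable_pair_avg mF mG F0 G0.
have A0 := pair_avg_ge0 F0 G0.
have H1 : (\int[lebesgue_measure]_x (`|S x| `^ c) <=
    (K `^ q * C0)%:E * (IF `^ (c / a) * IG `^ (c / b)))%E.
  apply: (@le_trans _ _ (\int[lebesgue_measure]_x
      ((K `^ q)%:E * pair_avg (sqnorm f) (sqnorm g) x `^ q))%E).
    apply: ge0_le_integralT => x; first exact: poweR_ge0.
    rewrite /S /square_function gee0_abs ?poweR_ge0// -poweRrM [2^-1 * c]mulrC -/q.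
    rewrite -poweR_EFin -poweRM ?lee_fin//.
    rewrite gt0_ler_poweR ?(ltW q0) ?in_itv/= ?leey ?andbT//.
    - by apply: esum_ge0 => n _; rewrite lee_fin sqr_ge0.
    - by rewrite mule_ge0 ?lee_fin.
    - exact: HK.
  rewrite ge0_integralZl ?lee_fin ?powR_ge0//; last 2 first.
  - exact: (measurableT_comp (measurable_poweR q) mA).
  - by move=> x _; exact: poweR_ge0.
  rewrite EFinM -muleA lee_wpmul2l ?lee_fin ?powR_ge0//.
  by rewrite -qr1 -qr2; exact: (HC _ _ M).
have cF : cLnorm a%:E f = (IF `^ a^-1)%E by exact: cLnormE.
have cG : cLnorm b%:E g = (IG `^ b^-1)%E by exact: cLnormE.
rewrite cF cG unlock /=.
apply: (@le_trans _ _ (((K `^ q * C0)%:E * (IF `^ (c / a) * IG `^ (c / b))) `^ c^-1)%E).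
  rewrite gt0_ler_poweR ?invr_ge0 ?(ltW c0) ?in_itv/= ?leey ?andbT//.
  - by apply: integral_ge0 => x _; exact: poweR_ge0.
  - by rewrite !mule_ge0 ?poweR_ge0// lee_fin mulr_ge0 ?powR_ge0.
have E (d : R) : c / d / c = d^-1 by rewrite mulrAC mulfV ?mul1r// gt_eqF.
rewrite !poweRM ?mule_ge0 ?poweR_ge0 ?lee_fin ?mulr_ge0 ?powR_ge0//.
rewrite -!poweRrM !E muleA poweR_EFin -/B.
by rewrite !lee_wpmul2r ?poweR_ge0// lee_fin lerDl.
Qed.
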